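(* Let $F$ be a finite extension of $\mathbb{Q}_p$, $n\geq2$, $\gcd(d,n)=1$, $G=\mathrm{PGL}_n$, $\mu$ the minuscule cocharacter induced by $(1^d,0^{n-d})$, and $X=\mathcal{F}\ell(G,\mu)$ with stable locus $X^s\subset X^{\mathrm{Berk}}$. Then the retraction map $r:X^s\to\mathcal{B}(G,F)$ is continuous.
   Context: **Setting.** $X=\mathcal{F}\ell(G,\mu)=G/P_\mu$ is the Grassmannian of $d$-dimensional subspaces of $F^n$. $\mathcal{L}$ is a $G$-linearized very ample line bundle on $X$, a sufficiently divisible power of the Plücker line bundle. For a maximal split torus $T$ with apartment $A_T\subset\mathcal{B}(G,F)$, $X(T,\mathcal{L})^s\subset X$ is the open subscheme of GIT (properly) stable points for the $T$-action with respect to $\mathcal{L}$; since $\gcd(d,n)=1$ it equals the semistable locus, i.e. the union of the non-vanishing loci of $T$-invariant sections of powers of $\mathcal{L}$. $X(T,\mathcal{L})^{s,\mathrm{Berk}}\subset X^{\mathrm{Berk}}$ is its Berkovich analytification. $X^s=\bigcap_TX(T,\mathcal{L})^{s,\mathrm{Berk}}$, $T$ running over all maximal $F$-split tori of $G$ (equivalently, the points given by $d$-dimensional $W\subset K^n$ with $\dim(U_K\cap W)/\dim U<d/n$ for all $F$-subspaces $0\neq U\subsetneq F^n$); it is open in $X^{\mathrm{Berk}}$. **Apartment retraction $r_A$, $A=A_T$.** Choose a special vertex $o\in A_T$. It defines a reductive model of $G$ over $O_F$; $T$, $P_\mu$, $X$, $\mathcal{L}$ and the stable ($=$ semistable) locus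 $X(T,\mathcal{L})^s$ extend over $O_F$. Let $K|F$ be an algebraically closed complete non-archimedean extension, $v:K^*\to\mathbb{R}$ the additive valuation with $v(\pi)=1$ ($\pi$ a uniformizer of $F$), and $v_T:T(K)\cong\mathrm{Hom}(X^*(T),K^* )\to\mathrm{Hom}(X^*(T),\mathbb{R})$. Identify $A_T$ with $\mathrm{Hom}(X^*(T),\mathbb{R})$ with origin $o$, where (Tits's sign convention) $t$ acts on $A_T$ by translation by $-v_T(t)$. Every $x\in X(T,\mathcal{L})^s(K)$ is $t\cdot y$ with $t\in T(K)$, $y\in X(T,\mathcal{L})^s(O_K)$, and $r_A(x):=-v_T(t)$ is well defined. Letting $K$ vary gives a map $r_A:X(T,\mathcal{L})^{s,\mathrm{Berk}}\to A_T$; it is independent of $o$. **The retraction map.** For $z\in\mathcal{B}(G,F)$ put $Y_z=\bigcap_{A\ni z}r_A^{-1}(z)\subset X^{\mathrm{Berk}}$, the intersection over all apartments $A$ containing $z$. One has $Y_z\subset X^s$ and $X^s=\coprod_{z\in\mathcal{B}(G,F)}Y_z$. The retraction map $r:X^s\to\mathcal{B}(G,F)$ sends every point of $Y_z$ to $z$. *)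

(* Defs.v *)
(* The notations of multinomials are not imported: they
   clash with those of MathComp-Analysis. *)
From HB Require Import structures.
From mathcomp Require Import all_boot all_order all_algebra.
From mathcomp Require Import all_field.
From mathcomp Require Import all_classical all_reals all_analysis.
From mathcomp Require mpoly.
Import -(notations) mpoly.

Set Implicit Arguments.
Unset Strict Implicit.
Unset Printing Implicit Defensive.

Import Order.TTheory GRing.Theory Num.Theory.
Import numFieldNormedType.Exports.

Local Open Scope classical_set_scope.
Local Open Scope ring_scope.
Local Open Scope quotient_scope.

Definition nonarch_abs (R : realType) (K : fieldType) (abs : K -> R) : Prop :=
  [/\ forall x, 0 <= abs x,
      forall x, abs x = 0 <-> x = 0,
      forall x y, abs (x * y) = abs x * abs y
    & forall x y, abs (x + y) <= Num.max (abs x) (abs y)].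

Definition abs_complete (R : realType) (K : fieldType) (abs : K -> R) : Prop :=
  forall u : nat -> K,
    (forall e : R, 0 < e -> exists N, forall i j,
       (N <= i)%N -> (N <= j)%N -> abs (u i - u j) < e) ->
    exists l, forall e : R, 0 < e -> exists N, forall i,
      (N <= i)%N -> abs (u i - l) < e.

(* (Qp, abs) is the completion of the rationals for the p-adic absolute value:
   a non-archimedean absolute value with |p| = 1/p restricts to the p-adic one
   on the rationals. *)
Definition padic_numbers (R : realType) (p : nat) (Qp : fieldType)
    (abs : Qp -> R) : Prop :=
  [/\ prime p, nonarch_abs abs, abs p%:R = p%:R^-1, abs_complete abs
    & forall (x : Qp) (e : R), 0 < e -> exists q : rat, abs (x - ratr q) < e].

Definition uniformizer (R : realType) (F : fieldType) (abs : F -> R) (pi : F) :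
    Prop :=
  [/\ pi != 0, abs pi < 1 & forall x, abs x < 1 -> abs x <= abs pi].

Section Plucker.

Variables (n d : nat).

(* Pluecker coordinates are indexed by i_1 < ... < i_d in {0, ..., n-1}. *)
Definition pidx := {t : d.-tuple 'I_n | sorted ltn (map val t)}.

Definition pdim : nat := #|{: pidx}|.

Definition pidx_val (I : 'I_pdim) : 'I_d -> 'I_n :=
  tnth (val (enum_val I)).

(* A d-dimensional subspace W of K^n is given by an n x d matrix of rank d
   whose columns span W. *)
Definition plucker (K : comNzRingType) (M : 'M[K]_(n, d)) (I : 'I_pdim) : K :=
  \det (rowsub (pidx_val I) M).

Definition polyring (F : fieldType) := mpoly pdim F.

Definition homog (F : fieldType) (k : nat) (f : polyring F) : Prop :=
  f \is ishomog1 k (@mdeg pdim).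

Definition pvar (F : fieldType) (I : 'I_pdim) : polyring F :=
  @mpolyX pdim F (mnm1 I).

(* f(v), the coefficients of f being mapped to K by iota *)
Definition peval (F : fieldType) (K : comNzRingType) (iota : F -> K)
    (v : 'I_pdim -> K) (f : polyring F) : K :=
  mmap iota v f.

Definition generic_mx (F : fieldType) : 'M[mpoly (n * d) F]_(n, d) :=
  \matrix_(i, j) @mpolyX (n * d) F (mnm1 (mxvec_index i j)).

(* The homogeneous ideal of the Grassmannian in its Pluecker embedding: sections
   of the k-th power of the Pluecker bundle are forms of degree k modulo it. *)
Definition plucker_ideal (F : fieldType) (f : polyring F) : Prop :=
  peval (@mpolyC (n * d) F) (plucker (generic_mx F)) f = 0.

(* The pullback of f along W |-> h W, i.e., along the d-th exterior power of
   h. *)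
Definition pullback (F : fieldType) (h : 'M[F]_n) (f : polyring F) :
    polyring F :=
  peval (@mpolyC pdim F)
    (fun I => \sum_J \det (mxsub (pidx_val I) (pidx_val J) h) *: pvar F J) f.

(* A basis of F^n (the columns of g) determines the maximal split torus
   {g diag(t) g^-1} modulo scalars of PGL_n, and every maximal split torus is of
   this form. *)
Definition torus_mx (K : fieldType) (g : 'M[K]_n) (t : 'I_n -> K) : 'M[K]_n :=
  g *m diag_mx (\row_i t i) *m invmx g.

(* Invariance of the section f of O(k), n | k, under the torus of g.  The
   PGL_n-linearization of O(k) is the GL_n-linearization twisted by the
   power kd/n of the determinant that makes the scalars act trivially. *)
Definition torus_invariant (F : fieldType) (g : 'M[F]_n) (k : nat)
    (f : polyring F) : Prop :=
  forall t : 'I_n -> F, (forall i, t i != 0) ->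
    let h := torus_mx g t in
    plucker_ideal (pullback h f - \det h ^+ (k %/ n * d) *: f).

(* The invariant sections of L^j, j > 0, where L = O(m). *)
Definition invariant_section (F : fieldType) (m : nat) (g : 'M[F]_n)
    (k : nat) (f : polyring F) : Prop :=
  [/\ exists2 j, (0 < j)%N & k = (m * j)%N, homog k f & torus_invariant g k f].

End Plucker.

Section Berkovich.

Variables (R : realType) (F : fieldType) (abs : F -> R) (n d : nat).

Local Notation P := (polyring n d F).

(* The points of the analytification of the affine cone of X, without its
   apex. *)
Definition cone_point (x : P -> R) : Prop :=
  [/\ [/\ forall f, 0 <= x f,
          forall c : F, x (@mpolyC (pdim n d) F c) = abs c,
          forall f h, x (f * h) = x f * x h
        & forall f h, x (f + h) <= Num.max (x f) (x h)],
      forall f, plucker_ideal f -> x f = 0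
    & exists I, x (pvar F I) != 0].

Definition cone : Type := {x : P -> R | cone_point x}.

HB.instance Definition _ := gen_eqMixin cone.
HB.instance Definition _ := gen_choiceMixin cone.
HB.instance Definition _ := Topological.copy cone
  (initial_topology (fun x : cone => sval x : {ptws P -> R})).

Definition cone_eq (x y : cone) : bool :=
  `[< exists2 c : R, 0 < c &
      forall k f, homog k f -> sval y f = c ^+ k * sval x f >].

Lemma cone_eq_equiv : equiv_class_of cone_eq.
Proof.
have sym x y : cone_eq x y -> cone_eq y x.
  move=> /asboolP[c c0 H]; apply/asboolP; exists c^-1; first by rewrite invr_gt0.
  move=> k f hf; rewrite (H _ _ hf) mulrA -exprMn mulVf ?gt_eqF//.
  by rewrite expr1n mul1r.
split=> [x|x y|y x z].
- by apply/asboolP; exists 1 => // k f _; rewrite expr1n mul1r.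
- by apply/idP/idP; exact: sym.
- move=> /asboolP[a a0 Ha] /asboolP[b b0 Hb]; apply/asboolP.
  exists (b * a); first exact: mulr_gt0.
  by move=> k f hf; rewrite (Hb _ _ hf) (Ha _ _ hf) mulrA exprMn.
Qed.

Canonical cone_equiv := EquivRelPack cone_eq_equiv.

(* The analytification of X as the quotient of the punctured cone by the
   multiplicative group. *)
Definition berk : Type := quotient_topology {eq_quot cone_equiv}.

HB.instance Definition _ :=
  Topological.copy berk (quotient_topology {eq_quot cone_equiv}).
HB.instance Definition _ := Quotient.copy berk {eq_quot cone_equiv}.

(* For f homogeneous, whether this vanishes does not depend on the
   representative. *)
Definition berk_val (x : berk) (f : P) : R := sval (repr x : cone) f.

(* x is the point of the analytification defined by the K-point of X that is
   the column space of M. *)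
Definition point_of (K : fieldType) (iota : F -> K) (absK : K -> R)
    (M : 'M[K]_(n, d)) (x : berk) : Prop :=
  exists2 c : R, 0 < c & forall k (f : P), homog k f ->
    absK (peval iota (plucker M) f) = c ^+ k * berk_val x f.

Definition torus_stable (m : nat) (g : 'M[F]_n) : set berk :=
  [set x | exists k f, invariant_section m g k f /\ berk_val x f != 0].

Definition stable_locus (m : nat) : set berk :=
  \bigcap_(g in [set g : 'M[F]_n | g \in unitmx]) torus_stable m g.

End Berkovich.

Arguments stable_locus {R F} abs n d m.

Section Building.

Variables (R : realType) (F : fieldType) (abs : F -> R) (pi : F) (n : nat).

(* The multiplicative form of the norm sum_i c_i g_i |-> min_i (v(c_i) + a_i),
   with v(pi) = 1. *)
Definition basis_norm (g : 'M[F]_n) (a : 'I_n -> R) (w : 'cV[F]_n) : R :=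
  \big[Num.max/0]_(i < n) (abs ((invmx g *m w) i 0) * abs pi `^ a i).

(* The point a of the apartment of g, identified with R^n modulo the diagonal;
   the origin is the special vertex given by the lattice spanned by the columns
   of g, and g diag(t) g^-1 translates by -v(t). *)
Definition apt_point (g : 'M[F]_n) (a : 'I_n -> R) : set ('cV[F]_n -> R) :=
  [set N | exists2 c : R, 0 < c & forall w, N w = c * basis_norm g a w].

(* The Bruhat-Tits building of PGL_n over F, as the set of homothety classes of
   splittable norms on F^n. *)
Definition building : Type :=
  {z : set ('cV[F]_n -> R) |
    exists2 g, g \in unitmx & exists a, z = apt_point g a}.

HB.instance Definition _ := gen_eqMixin building.
HB.instance Definition _ := gen_choiceMixin building.

Definition in_apartment (g : 'M[F]_n) (z : building) : Prop :=
  exists a, sval z = apt_point g a.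

(* Two points lie in a common apartment, on which the metric is the quotient of
   the euclidean metric of R^n by the diagonal. *)
Definition building_ball (z : building) (e : R) : set building :=
  [set w | exists g a b, [/\ g \in unitmx, sval z = apt_point g a,
     sval w = apt_point g b & \sum_i (a i - b i) ^+ 2 < e ^+ 2]].

Definition building_open (U : set building) : Prop :=
  forall z, U z -> exists2 e : R, 0 < e & building_ball z e `<=` U.

Lemma building_openT : building_open setT.
Proof. by move=> z _; exists 1. Qed.

Lemma building_openI : setI_closed building_open.
Proof.
move=> A B oA oB z [/oA[a a0 Aa] /oB[b b0 Bb]].
have le_ball e e' : 0 < e -> e <= e' ->
    building_ball z e `<=` building_ball z e'.
  move=> e0 le w [g [u [v [gu zu wv lt]]]]; exists g, u, v; split=> //.
  by apply: lt_le_trans lt _; rewrite lerXn2r// nnegrE ltW// (lt_le_trans e0).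
exists (Num.min a b); first by rewrite lt_min a0.
by move=> w zw; split; [apply: Aa|apply: Bb]; apply: le_ball zw;
  rewrite ?lt_min ?a0// ge_min lexx ?orbT.
Qed.

Lemma building_open_bigU (I : Type) (f : I -> set building) :
  (forall i, building_open (f i)) -> building_open (\bigcup_i f i).
Proof.
move=> of_ z [i _ /of_[e e0 sub]]; exists e => // w /sub fw.
by exists i.
Qed.

HB.instance Definition _ := @isOpenTopological.Build building building_open
  building_openT building_openI building_open_bigU.

End Building.

Section Retraction.

Variables (R : realType) (F : fieldType) (abs : F -> R) (pi : F).
Variables (n d m : nat).

(* The column space of M is a point over the valuation ring of K of the stable
   locus of the diagonal torus on the Grassmannian over the valuation ring of
   F: M is a basis of a direct summand of rank d of the standard lattice, and
   some invariant section with integral coefficients does not vanish on its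
   reduction. *)
Definition integral_stable (K : fieldType) (iota : F -> K) (absK : K -> R)
    (M : 'M[K]_(n, d)) : Prop :=
  [/\ forall i j, absK (M i j) <= 1,
      exists I, absK (plucker M I) = 1
    & exists k (f : polyring n d F),
        [/\ invariant_section m 1%:M k f,
            forall mon, abs (mcoeff mon f) <= 1
          & absK (peval iota (plucker M) f) = 1]].

(* r_A(x) = z for the apartment A of g.  The origin is the vertex of the lattice
   spanned by the columns of g, and g identifies its model of X over the
   valuation ring with the standard one, so that x is (g diag(t) g^-1) g W for an
   integral stable point W. *)
Definition apt_retraction (g : 'M[F]_n) (x : berk abs n d)
    (z : building abs pi n) : Prop :=
  exists (K : closedFieldType) (iota : {rmorphism F -> K}) (absK : K -> R)
    (t : 'I_n -> K) (W : 'M[K]_(n, d)),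
  [/\ [/\ nonarch_abs absK, abs_complete absK
        & forall c, absK (iota c) = abs c],
      forall i, t i != 0,
      integral_stable iota absK W,
      point_of iota absK
        (torus_mx (map_mx iota g) t *m (map_mx iota g *m W)) x
    & sval z = apt_point abs pi g (fun i => - (ln (absK (t i)) / ln (abs pi)))].

(* As g ranges over the bases adapted to z, both the apartments containing z and
   the choices of origin are exhausted. *)
Definition fibre (z : building abs pi n) : set (berk abs n d) :=
  [set x | forall g, g \in unitmx -> in_apartment g z -> apt_retraction g x z].

(* The stable locus is the disjoint union of the sets fibre z; the retraction
   is the map that sends every point of fibre z to z. *)
Definition is_retraction
    (r : set_type (stable_locus abs n d m) -> building abs pi n) :
    Prop :=
  forall x z, fibre z (set_val x) <-> r x = z.

End Retraction.

(* Main.v *)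
(* For x in the stable locus, a point z of the building and a basis g adapted to
   z, let u_I be the size at x of the Pluecker coordinate I with respect to g,
   normalized by the norm z.  If z = r(x), the reduction of x in these
   coordinates is semistable; as d is prime to n, a greedy choice of a basis of
   the matroid of this reduction shows that for every direction mu in the
   apartment of g some I with u_I maximal satisfies
   n mu_I - d (sum of mu) >= max mu - min mu.
   Let x0 and x be stable, and let b - a be the difference of r(x) and r(x0) in a
   common apartment of both.  Applying this to x0 with mu = a - b and to x with
   mu = b - a gives index sets I and J, and comparing the coordinates I and J of x
   bounds the oscillation of b - a by any given eta > 0 as soon as the
   coordinates that are maximal at x0 with respect to r(x0) are almost maximal
   at x with respect to r(x0).  Since the residue field is finite, there are only
   finitely many such coordinates up to scaling and small perturbations, so this
   holds on a neighbourhood of x0. *)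
Require Import Defs.
From mathcomp Require Import all_boot all_order all_fingroup all_algebra.
From mathcomp Require Import all_field.
From mathcomp Require Import all_classical all_reals all_analysis.
From mathcomp Require mpoly.
From mathcomp Require Import ring lra.
Import -(notations) mpoly.
Import numFieldNormedType.Exports.
Import Order.TTheory GRing.Theory Num.Theory.

Set Implicit Arguments.
Unset Strict Implicit.
Unset Printing Implicit Defensive.

Local Open Scope classical_set_scope.
Local Open Scope quotient_scope.
Local Open Scope ring_scope.

(** * Multiplicative seminorms and minors *)

(** Seminorms may have a kernel, so absolute values of fields and points of the analytification are
    treated alike. *)
Definition seminorm (R : realType) (A : comNzRingType) (s : A -> R) : Prop :=
  [/\ forall a, 0 <= s a, s 0 = 0, s 1 = 1,
      forall a b, s (a * b) = s a * s b
    & forall a b, s (a + b) <= Num.max (s a) (s b)].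

Lemma nonarch_abs_seminorm (R : realType) (K : fieldType) (abs : K -> R) :
  nonarch_abs abs -> seminorm abs.
Proof.
move=> [ge0 eq0 mul ult]; split=> //; first exact/eq0.
have /eqP := mul 1 1; rewrite mulr1 -subr_eq0 -{1}[abs 1]mulr1 -mulrBr mulf_eq0.
have /eqP/negbTE -> : abs 1 <> 0 by move/eq0/eqP; rewrite oner_eq0.
by rewrite subr_eq0 => /eqP.
Qed.

Section Seminorm.
Variables (R : realType) (A : comNzRingType) (s : A -> R).
Hypothesis hs : seminorm s.

Lemma snorm_ge0 a : 0 <= s a. Proof. by have [] := hs. Qed.
Lemma snorm0 : s 0 = 0. Proof. by have [] := hs. Qed.
Lemma snorm1 : s 1 = 1. Proof. by have [] := hs. Qed.
Lemma snormM a b : s (a * b) = s a * s b. Proof. by have [] := hs. Qed.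
Lemma snormD a b : s (a + b) <= Num.max (s a) (s b).
Proof. by have [] := hs. Qed.

Lemma snormX a k : s (a ^+ k) = s a ^+ k.
Proof.
by elim: k => [|k IH]; rewrite ?expr0 ?snorm1// !exprS snormM IH.
Qed.

Lemma snorm_prod (I : Type) (r : seq I) (P : pred I) (F : I -> A) :
  s (\prod_(i <- r | P i) F i) = \prod_(i <- r | P i) s (F i).
Proof. exact: (big_morph s snormM snorm1). Qed.

Lemma snormN1 : s (-1) = 1.
Proof.
have /eqP := snormX (-1) 2; rewrite sqrrN expr1n snorm1 eq_sym sqrf_eq1.
case/orP => /eqP h; rewrite ?h //; have := snorm_ge0 (-1); rewrite h; lra.
Qed.

Lemma snormN a : s (- a) = s a.
Proof. by rewrite -mulN1r snormM snormN1 mul1r. Qed.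

Lemma snorm_sign k : s ((-1) ^+ k) = 1.
Proof. by rewrite snormX snormN1 expr1n. Qed.

Lemma snormB a b : s (a - b) <= Num.max (s a) (s b).
Proof. by rewrite -(snormN b) snormD. Qed.

Lemma snorm_sum_le (I : Type) (r : seq I) (P : pred I) (F : I -> A) C :
  0 <= C -> (forall i, P i -> s (F i) <= C) -> s (\sum_(i <- r | P i) F i) <= C.
Proof.
move=> C0 le; apply: (big_ind (fun a => s a <= C)) => // [|a b ha hb].
  by rewrite snorm0.
by apply: le_trans (snormD _ _) _; rewrite ge_max ha.
Qed.

Lemma snorm_sum_ge (I : eqType) (r : seq I) (P : pred I) (F : I -> A) C :
  0 < C -> C <= s (\sum_(i <- r | P i) F i) ->
  exists2 i, (i \in r) && P i & C <= s (F i).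
Proof.
move=> C0 Cs; apply: contrapT => /forall2NP h; move: Cs; apply/negP.
rewrite -ltNge big_seq_cond.
apply: (big_ind (fun a => s a < C)) => [|a b ha hb|i iP].
- by rewrite snorm0.
- by apply: le_lt_trans (snormD _ _) _; rewrite gt_max ha.
- by case: (h i) => // /negP; rewrite -ltNge.
Qed.

Lemma snorm_close a b : s (a - b) < s a -> s b = s a.
Proof.
move=> lt; apply: le_anti; apply/andP; split.
  have := snormB a (a - b); rewrite opprB addrC subrK => /le_trans; apply.
  by rewrite ge_max lexx (ltW lt).
have := snormD (a - b) b; rewrite subrK le_max => /orP[]//.
by rewrite leNgt lt.
Qed.

Lemma snorm_eq_mod a b : s (a - b) = 0 -> s a = s b.
Proof.
move=> h; have := snorm_ge0 a; rewrite le_eqVlt => /orP[/eqP a0|a0].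
  have := snormB a (a - b); rewrite h -a0 opprB addrC subrK maxxx => b0.
  by apply: le_anti; rewrite b0 snorm_ge0.
by rewrite (@snorm_close a b) // h.
Qed.

End Seminorm.

Lemma snormV (R : realType) (K : fieldType) (s : K -> R) (hs : seminorm s) x :
  s x^-1 = (s x)^-1.
Proof.
have [->|x0] := eqVneq x 0; first by rewrite invr0 (snorm0 hs) invr0.
have e : s x * s x^-1 = 1 by rewrite -(snormM hs) divff// (snorm1 hs).
have nz : s x != 0.
  by apply/eqP => h; move/eqP: e; rewrite h mul0r eq_sym oner_eq0.
by apply: (mulfI nz); rewrite e divff.
Qed.

Lemma snorm_gt0 (R : realType) (K : fieldType) (s : K -> R) (hs : seminorm s) x :
  x != 0 -> 0 < s x.
Proof.
move=> x0; rewrite lt_def (snorm_ge0 hs) andbT; apply/eqP => h.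
have := snormM hs x x^-1; rewrite divff// (snorm1 hs) h mul0r => /eqP.
by rewrite oner_eq0.
Qed.

Section Leibniz.
Variables (R : realType) (A : comNzRingType) (s : A -> R).
Hypothesis hs : seminorm s.

Lemma snorm_det_le d (M : 'M[A]_d) C :
  0 <= C -> (forall t : 'S_d, \prod_j s (M j (t j)) <= C) -> s (\det M) <= C.
Proof.
move=> C0 h; apply: snorm_sum_le => // t _.
by rewrite (snormM hs) (snorm_sign hs) mul1r (snorm_prod hs).
Qed.

Lemma snorm_det_ge d (M : 'M[A]_d) C :
  0 < C -> C <= s (\det M) -> exists t : 'S_d, C <= \prod_j s (M j (t j)).
Proof.
move=> C0 h; have [t _] := snorm_sum_ge hs C0 h.
by rewrite (snormM hs) (snorm_sign hs) mul1r (snorm_prod hs); exists t.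
Qed.

End Leibniz.

(** Multilinearity in the rows. All maps [e] are kept, so the coefficients are products of entries
    and are estimated factor by factor. *)
Lemma det_rowsub_mul (A : comNzRingType) n m d (h : 'M[A]_(m, n))
    (M : 'M[A]_(n, d)) (f : 'I_d -> 'I_m) :
  \det (rowsub f (h *m M)) =
  \sum_(e : {ffun 'I_d -> 'I_n}) (\prod_j h (f j) (e j)) * \det (rowsub e M).
Proof.
pose AB (s : 'S_d) i k := h (f i) k * M k (s i).
transitivity (\sum_(e : {ffun 'I_d -> 'I_n}) \sum_(s : 'S_d)
    (-1) ^+ s * \prod_i AB s i (e i)).
  rewrite exchange_big; apply: eq_bigr => /= s _; rewrite -big_distrr /=.
  congr (_ * _); rewrite -(bigA_distr_bigA (AB s)) /=.
  by apply: eq_bigr => i _; rewrite !mxE.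
apply: eq_bigr => e _; rewrite big_distrr; apply: eq_bigr => s _.
rewrite /= mulrCA big_split; congr (_ * (_ * _)).
by apply: eq_bigr => i _; rewrite mxE.
Qed.

(* Cramer's rule. *)
Lemma mul_invmx_rowsub (K : fieldType) n d (M : 'M[K]_(n, d))
    (f : 'I_d -> 'I_n) i j :
  rowsub f M \in unitmx ->
  (M *m invmx (rowsub f M)) i j =
  (\det (rowsub f M))^-1 * \det (rowsub (fun l => if l == j then i else f l) M).
Proof.
move=> u; rewrite /invmx u -scalemxAr mxE; congr (_ * _).
rewrite mxE (expand_det_row _ j); apply: eq_bigr => k _.
rewrite !mxE eqxx; congr (_ * _); rewrite /cofactor; congr (_ * \det _).
by apply/matrixP => a b; rewrite !mxE eq_sym (negbTE (neq_lift _ _)).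
Qed.

(** * Semistable reductions *)

(* By induction on the number of levels of [mu], lowering the top level to the
   next one. *)
Lemma upper_set_sum_ge (R : realType) n (w mu : 'I_n -> R) :
  \sum_i w i = 0 ->
  (forall S : {set 'I_n}, S != finset.set0 -> S != finset.setT ->
     (forall i i', i \in S -> i' \notin S -> mu i' < mu i) ->
     1 <= \sum_(i in S) w i) ->
  forall i i', mu i - mu i' <= \sum_i w i * mu i.
Proof.
move=> w0; move Dk : #|[pred i | [exists j, mu i < mu j]]| => k.
elim/ltn_ind: k mu Dk => k IH mu Dk hS a b.
have [k0|k0] := posnP k.
  have cst i j : mu i = mu j.
    apply: le_anti; apply/andP; split; rewrite leNgt; apply/negP => lt.
      have : 0%N != #|[pred i | [exists j, mu i < mu j]]|.
        by rewrite eq_sym -lt0n; apply/card_gt0P; exists j; apply/existsP; exists i.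
      by rewrite Dk k0.
    have : 0%N != #|[pred i | [exists j, mu i < mu j]]|.
      by rewrite eq_sym -lt0n; apply/card_gt0P; exists i; apply/existsP; exists j.
    by rewrite Dk k0.
  rewrite (cst b a) subrr (eq_bigr (fun i => w i * mu a)) => [|i _].
    by rewrite -mulr_suml w0 mul0r.
  by rewrite (cst i a).
have /card_gt0P[c0 /existsP hc0] : (0 < #|[pred i | [exists j, (mu i < mu j)%R]]|)%N.
  by rewrite Dk.
pose top := [arg max_(i > c0) mu i]%O.
have topP i : mu i <= mu top by rewrite /top; case: arg_maxP => // j _; exact.
have c0P : mu c0 < mu top by case: hc0 => j /lt_le_trans; apply.
pose sec := [arg max_(i > c0 | mu i < mu top) mu i]%O.
have [sec_lt secP] : mu sec < mu top /\
    forall i, mu i < mu top -> mu i <= mu sec.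
  by rewrite /sec; case: arg_maxP.
pose mu' i := if mu i < mu top then mu i else mu sec.
have eqtop i : (mu i < mu top) = false -> mu i = mu top.
  by move=> /negbT; rewrite -leNgt => h; apply: le_anti; rewrite topP.
have mu'sec i : mu' i <= mu sec by rewrite /mu'; case: ifP => // /secP.
pose S := [set i | mu i == mu top]%SET.
have S1 : 1 <= \sum_(i in S) w i.
  apply: hS.
  - by apply/set0Pn; exists top; rewrite inE.
  - by apply/eqP => /setP/(_ c0); rewrite !inE lt_eqF.
  - by move=> i i'; rewrite !inE => /eqP -> /negbTE ne; rewrite lt_neqAle ne topP.
(* Lowering the top level lowers the weighted sum by the gap times the weight of that level, hence
   by at least the gap, while [mu a - mu b] drops by at most the gap. *)
have sumE : \sum_i w i * mu i =
    \sum_i w i * mu' i + (mu top - mu sec) * \sum_(i in S) w i.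
  rewrite [X in _ * X]big_mkcond /= mulr_sumr -big_split /=.
  apply: eq_bigr => i _; rewrite !inE /mu'; case: ifP => [lt|/eqtop ->].
    by rewrite lt_eqF// mulr0 addr0.
  by rewrite eqxx; ring.
have hlt : (#|[pred i | [exists j, (mu' i < mu' j)%R]]| < k)%N.
  rewrite -Dk; apply: proper_card; apply/fintype.properP; split.
    apply/fintype.subsetP => i; rewrite !inE => /existsP[j lt]; apply/existsP; exists top.
    rewrite ltNge; apply/negP => le; have := lt_le_trans lt (mu'sec j).
    by rewrite {1}/mu' [mu i < mu top]ltNge le ltxx.
  exists sec; rewrite !inE; first by apply/existsP; exists top.
  apply/negP => /existsP[j]; rewrite {1}/mu' sec_lt => /lt_le_trans/(_ (mu'sec j)).
  by rewrite ltxx.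
have IHmu' : mu' a - mu' b <= \sum_i w i * mu' i.
  apply: (IH _ hlt _ erefl) => T T0 TT up; apply: hS => // i i' iT i'T.
  have := up _ _ iT i'T; rewrite [mu' i']/mu'; case: ifP => [i'lt|_]; last first.
    by move=> /lt_le_trans/(_ (mu'sec i)); rewrite ltxx.
  by rewrite /mu'; case: ifP => // /eqtop -> /lt_trans; apply.
rewrite sumE.
have g0 : 0 < mu top - mu sec by rewrite subr_gt0.
have g1 : mu top - mu sec <= (mu top - mu sec) * \sum_(i in S) w i.
  by rewrite ler_peMr// ltW.
have ha : mu a <= mu' a + (mu top - mu sec).
  by rewrite /mu'; case: ifP => [_|/eqtop ->]; lra.
have hb : mu' b <= mu b.
  by rewrite /mu'; case: ifP => [_|/eqtop ->]; rewrite ?lexx// ltW.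
lra.
Qed.

Section Greedy.
Variables (R : realType) (K : fieldType) (s : K -> R).
Hypothesis hs : seminorm s.
Variables (n d : nat) (W : 'M[K]_(n, d)).
Hypothesis W1 : forall i j, s (W i j) <= 1.

Lemma minor_le1 (f : 'I_d -> 'I_n) : s (\det (rowsub f W)) <= 1.
Proof.
apply: snorm_det_le => // t; apply: prodr_ile1 => j _.
by rewrite mxE (snorm_ge0 hs) W1.
Qed.

(* The greedy algorithm for the matroid of the reduction of [W]: [f] has maximal
   weight, so once the minor [f] is normalized to the identity, the entry (i, j)
   has absolute value 1 only if [mu i <= mu (f j)]. *)
Lemma greedy_basis (mu : 'I_n -> R) (f0 : {ffun 'I_d -> 'I_n}) :
  s (\det (rowsub f0 W)) = 1 ->
  exists2 f : {ffun 'I_d -> 'I_n}, s (\det (rowsub f W)) = 1 &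
    forall (f' : {ffun 'I_d -> 'I_n}) (S : {set 'I_n}),
      s (\det (rowsub f' W)) = 1 ->
      (forall i i', i \in S -> i' \notin S -> mu i' < mu i) ->
      (#|[pred j | f' j \in S]| <= #|[pred j | f j \in S]|)%N.
Proof.
move=> h0; pose act (f : {ffun 'I_d -> 'I_n}) := s (\det (rowsub f W)) == 1.
have act0 : act f0 by apply/eqP.
pose f := [arg max_(f > f0 | act f) \sum_j mu (f j)]%O.
have [/eqP fact fmax] : act f /\
    forall f', act f' -> \sum_j mu (f' j) <= \sum_j mu (f j).
  by rewrite /f; case: arg_maxP.
have fu : rowsub f W \in unitmx.
  rewrite unitmxE unitfE; apply/eqP => h.
  by move/eqP: fact; rewrite h (snorm0 hs) eq_sym oner_eq0.
pose N := W *m invmx (rowsub f W).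
have NE i j : s (N i j) = s (\det (rowsub (fun l => if l == j then i else f l) W)).
  by rewrite mul_invmx_rowsub// (snormM hs) (snormV hs) fact invr1 mul1r.
have N1 i j : s (N i j) <= 1 by rewrite NE minor_le1.
have Nlt i j : 1 <= s (N i j) -> mu i <= mu (f j).
  move=> N_ge; pose f' := [ffun l => if l == j then i else f l].
  have : act f'.
    rewrite /act eq_le minor_le1 /=.
    rewrite (_ : rowsub f' W = rowsub (fun l => if l == j then i else f l) W) -?NE//.
    by apply/matrixP => a b; rewrite !mxE ffunE.
  move=> /fmax; rewrite (bigD1 j)//= [leRHS](bigD1 j)//= ffunE eqxx.
  rewrite (eq_bigr (fun j => mu (f j))) ?lerD2r// => l lj.
  by rewrite ffunE (negbTE lj).
exists f => // f' S fact' up.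
have detN : s (\det (rowsub f' N)) = 1.
  rewrite /N -mul_rowsub_mx det_mulmx (snormM hs) fact' det_inv (snormV hs) fact.
  by rewrite invr1 mulr1.
(* A Leibniz term of size 1 matches every [f' j] with some [f (t j)] of at least the same weight,
   which is in [S] whenever [f' j] is. *)
have [t ht] : exists t : 'S_d, 1 <= \prod_j s (rowsub f' N j (t j)).
  by apply: (snorm_det_ge hs); rewrite ?detN.
have t1 j : mu (f' j) <= mu (f (t j)).
  apply: Nlt; apply: le_trans ht _; rewrite (bigD1 j)//= mxE ler_piMr//.
    exact: snorm_ge0.
  by apply: prodr_ile1 => l _; rewrite mxE (snorm_ge0 hs) N1.
rewrite -(fintype.card_image (@perm_inj _ t)); apply: subset_leq_card.
apply/fintype.subsetP => _ /fintype.imageP[j jS ->]; rewrite !inE in jS *.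
by apply/negPn/negP => h; have := up _ _ jS h; rewrite ltNge t1.
Qed.

(* The condition on the sets [S] is the semistability of the reduction of [W]; as
   [d] is prime to [n], the inequality is strict for proper subsets. *)
Lemma stable_weight (hd : coprime d n) :
  (exists f0 : {ffun 'I_d -> 'I_n}, s (\det (rowsub f0 W)) = 1) ->
  (forall S : {set 'I_n}, exists2 f : {ffun 'I_d -> 'I_n},
     s (\det (rowsub f W)) = 1 & (d * #|S| <= n * #|[pred j | f j \in S]|)%N) ->
  forall mu : 'I_n -> R, exists2 f : {ffun 'I_d -> 'I_n},
    s (\det (rowsub f W)) = 1 & forall i i',
    mu i - mu i' <= n%:R * \sum_j mu (f j) - d%:R * \sum_i mu i.
Proof.
move=> [f0 h0] hS mu; have [f f1 fS] := greedy_basis mu h0.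
exists f => //.
pose w i : R := n%:R * #|[pred j | f j == i]|%:R - d%:R.
have sumw (S : {set 'I_n}) : \sum_(i in S) w i =
    n%:R * #|[pred j | f j \in S]|%:R - d%:R * #|S|%:R.
  rewrite sumrB -mulr_sumr sumr_const (mulr_natr d%:R); congr (_ * _ - _).
  rewrite -natr_sum -sum1_card (partition_big f [in S])//=.
  congr (_%:R); apply: eq_bigr => i iS; rewrite -sum1_card.
  by apply: eq_bigl => j; rewrite !inE; case: eqP => [->|]; rewrite ?iS ?andbF.
have -> : n%:R * \sum_j mu (f j) - d%:R * \sum_i mu i = \sum_i w i * mu i.
  under [RHS]eq_bigr do rewrite mulrBl -mulrA.
  rewrite sumrB -!mulr_sumr; congr (_ * _ - _).
  rewrite (partition_big f predT)//=; apply: eq_bigr => i _.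
  rewrite mulrC mulr_natr -sumr_const; apply: eq_big => j //=.
  by move=> /eqP ->.
apply: upper_set_sum_ge => [|S S0 ST up].
  have -> : \sum_i w i = \sum_(i in [set: 'I_n]%SET) w i.
    by apply: eq_bigl => i; rewrite inE.
  rewrite sumw cardsT card_ord mulrC (_ : #|_| = d) ?subrr//.
  by rewrite -[RHS]card_ord; apply: fintype.eq_card => j;
    rewrite unfold_in /= finset.in_setT.
have [f' f'1 f'S] := hS S.
rewrite sumw lerBrDr -!natrM nat1r ler_nat ltn_neqAle.
have le : (d * #|S| <= n * #|[pred j | f j \in S]|)%N.
  by apply: leq_trans f'S _; rewrite leq_mul2l fS ?orbT.
(* Equality would make [n] divide [d * #|S|], hence [#|S|], which is impossible for a nonempty
   proper subset. *)
rewrite le andbT; apply/eqP => e.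
have : (n %| d * #|S|)%N by rewrite e dvdn_mulr.
rewrite Gauss_dvdr; last by rewrite coprime_sym.
move=> /dvdn_leq; rewrite card_gt0 => /(_ S0); apply/negP; rewrite -ltnNge.
rewrite -[X in (_ < X)%N](card_ord n) -cardsT; apply: proper_card.
by rewrite properT.
Qed.

End Greedy.

(** * Evaluation at Pluecker vectors *)

Lemma rmorph_mmap (F A B : comNzRingType) n (g : {rmorphism A -> B}) (h : F -> A)
    (v : 'I_n -> A) (f : mpoly n F) :
  g (mmap h v f) = mmap (g \o h) (g \o v) f.
Proof.
rewrite /mmap rmorph_sum; apply: eq_bigr => m _; rewrite rmorphM; congr (_ * _).
by rewrite /mmap1 rmorph_prod; apply: eq_bigr => i _; rewrite rmorphXn.
Qed.

Lemma eq_mmap (F A : comNzRingType) n (h h' : F -> A) (v v' : 'I_n -> A)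
    (f : mpoly n F) :
  h =1 h' -> v =1 v' -> mmap h v f = mmap h' v' f.
Proof.
move=> eh ev; rewrite /mmap; apply: eq_bigr => m _.
by rewrite eh (mmap1_eq _ ev).
Qed.

Section Evaluation.
Variables (F : fieldType) (A : comNzRingType) (iota : {rmorphism F -> A}).

Lemma mmap_mmapC n k (v : 'I_n -> A) (w : 'I_k -> mpoly n F) (f : mpoly k F) :
  mmap iota v (mmap (@mpolyC n F) w f) = mmap iota (mmap iota v \o w) f.
Proof.
rewrite (rmorph_mmap (mmap iota v : {rmorphism mpoly n F -> A})).
by apply: eq_mmap => // c /=; rewrite mmapC.
Qed.

(** The generic matrix specializes to [M], so every relation between its minors holds for those of
    [M]. *)
Lemma peval_plucker_ideal n d (M : 'M[A]_(n, d)) (f : polyring n d F) :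
  plucker_ideal f -> peval iota (plucker M) f = 0.
Proof.
rewrite /plucker_ideal /peval => f0.
pose v k := mxvec M 0 k.
have := congr1 (mmap iota v) f0; rewrite mmap_mmapC mmap0 => <-.
apply: eq_mmap => // I /=; rewrite /plucker.
rewrite -(det_map_mx (mmap iota v : {rmorphism mpoly (n * d) F -> A})).
by congr (\det _); apply/matrixP => i j; rewrite !mxE /= mmapX mmap1U /v mxvecE.
Qed.

Lemma peval_pullback n d (v : 'I_(pdim n d) -> A) (h : 'M[F]_n)
    (f : polyring n d F) :
  peval iota v (pullback h f) =
  peval iota (fun I => \sum_J iota (\det (mxsub (pidx_val I) (pidx_val J) h)) * v J)
    f.
Proof.
rewrite /peval mmap_mmapC; apply: eq_mmap => // I /=.
rewrite raddf_sum; apply: eq_bigr => J _.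
by rewrite /= mmapZ /pvar mmapX mmap1U.
Qed.

End Evaluation.

(** * Pluecker index sets and torus invariants *)

Lemma pidx_val_inj n d (I : 'I_(pdim n d)) : injective (pidx_val I).
Proof.
move=> i j; rewrite /pidx_val; case: (enum_val I) => t /= st.
have u : uniq t.
  rewrite -(map_inj_uniq val_inj); apply: sorted_uniq st => //.
    exact: ltn_trans.
  exact: ltnn.
by move/tuple_uniqP: u; apply.
Qed.

Lemma injective_pidx n d (f : 'I_d -> 'I_n) :
  injective f ->
  exists (I : 'I_(pdim n d)) (s : 'S_d), forall j, f j = pidx_val I (s j).
Proof.
move=> fi; pose r : rel 'I_n := fun i j => (i <= j)%N.
pose t := sort r [seq f j | j <- enum 'I_d].
have sz : size t == d by rewrite size_sort size_map size_enum_ord.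
have rt : total r by move=> i j; exact: leq_total.
have ut : uniq t by rewrite sort_uniq map_inj_uniq// enum_uniq.
have st : sorted ltn (map val t).
  rewrite ltn_sorted_uniq_leq map_inj_uniq ?ut; last exact: val_inj.
  by rewrite sorted_map; exact: sort_sorted.
pose I : 'I_(pdim n d) := enum_rank (exist _ (Tuple sz) st : pidx n d).
have IE : forall j, pidx_val I j = tnth (Tuple sz) j.
  by move=> j; rewrite /pidx_val /I enum_rankK.
have im j : exists i, pidx_val I i == f j.
  have : f j \in t by rewrite mem_sort map_f// mem_enum.
  by move=> /(tnthP (Tuple sz))[i ->]; exists i; rewrite IE.
pose s0 j := xchoose (im j).
have s0E j : pidx_val I (s0 j) = f j by apply/eqP/(xchooseP (im j)).
have s0i : injective s0 by move=> i j e; apply: fi; rewrite -!s0E e.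
by exists I, (perm s0i) => j; rewrite permE s0E.
Qed.

(** The exterior power of a diagonal matrix is diagonal in the Pluecker basis: off the diagonal,
    some row of the submatrix has only zeros. *)
Lemma pidx_det_diag (F : fieldType) n d (D : 'M[F]_n) (I J : 'I_(pdim n d)) :
  (forall i j, i != j -> D i j = 0) ->
  \det (mxsub (pidx_val I) (pidx_val J) D) =
  (\prod_j D (pidx_val I j) (pidx_val I j)) *+ (I == J).
Proof.
move=> hD; have [<-|IJ] := eqVneq I J.
  rewrite mulr1n.
  rewrite [LHS](_ : _ = \det (diag_mx (\row_j D (pidx_val I j) (pidx_val I j)))).
    by rewrite det_diag; apply: eq_bigr => j _; rewrite mxE.
  congr (\det _); apply/matrixP => i j; rewrite !mxE.
  have [->//|ij] := eqVneq i j; rewrite ?mulr1n // hD//.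
  by apply: contra ij => /eqP/pidx_val_inj ->.
have [i hi] : exists i, forall j, pidx_val I i != pidx_val J j.
  apply: contrapT => /forallNP h; move/eqP: IJ; apply.
  have sub : {subset val (enum_val I) <= val (enum_val J)}.
    move=> x /tnthP[i xE]; have /existsNP[j /negP/negPn/eqP e] := h i.
    by rewrite xE -[tnth _ _]/(pidx_val I i) e mem_tnth.
  apply: enum_val_inj; apply: val_inj; apply: val_inj; apply: (inj_map val_inj).
  case: (enum_val I) (enum_val J) sub => [t st] [t' st'] /= sub.
  have ut : uniq t.
    rewrite -(map_inj_uniq val_inj); apply: sorted_uniq st => //.
      exact: ltn_trans.
    exact: ltnn.
  apply: (irr_sorted_eq ltn_trans ltnn st st'); apply: eq_mem_map.
  have szE : (size t' <= size t)%N by rewrite !size_tuple.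
  have [_ mem] := uniq_min_size ut sub szE.
  exact: mem.
rewrite mulr0n (expand_det_row _ i) big1// => j _.
by rewrite mxE hD ?mul0r// hi.
Qed.

Lemma torus_mx1 (F : fieldType) n (t : 'I_n -> F) :
  torus_mx 1%:M t = diag_mx (\row_i t i).
Proof. by rewrite /torus_mx invmx1 mulmx1 mul1mx. Qed.

(* A one-parameter subgroup acting by [tau] on the coordinates in [S] shows that
   only monomials of [f] of weight [d k |S| / n] contribute to the value of the
   invariant section [f]. *)
Lemma invariant_section_semistable (R : realType) (F K : fieldType)
    (iota : {rmorphism F -> K}) (s : K -> R) (hs : seminorm s) (tau : F)
    (htau : injective (fun i : nat => tau ^+ i)) n d k (f : polyring n d F)
    (M : 'M[K]_(n, d)) (S : {set 'I_n}) :
  (0 < k)%N -> (n %| k)%N -> homog k f -> torus_invariant 1%:M k f ->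
  (forall mon, s (iota (mcoeff mon f)) <= 1) ->
  (forall I, s (plucker M I) <= 1) ->
  s (peval iota (plucker M) f) = 1 ->
  exists2 I : 'I_(pdim n d), s (plucker M I) = 1 &
    (d * #|S| <= n * #|[pred j | pidx_val I j \in S]|)%N.
Proof.
move=> k0 nk fk finv f1 p1 fM.
have tau0 : tau != 0.
  apply/eqP => h; have := htau 1%N 2; rewrite h expr1 expr2 mul0r.
  by move=> /(_ erefl).
pose a I := #|[pred j | @pidx_val n d I j \in S]|.
pose N := (#|S| * (k %/ n * d))%N.
set c := peval iota (plucker M) f in fM.
(* [q] is [f] at the translate of the point by the one-parameter subgroup, with an indeterminate as
   parameter. *)
pose q : {poly K} := mmap (polyC \o iota)
  (fun I => 'X^(a I) * (plucker M I)%:P) f.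
(* Invariance gives the values of [q] at the powers of [tau]; the exponent [N] comes from the twist
   of the linearization by the determinant. *)
have qtau i : q.[iota (tau ^+ i)] = iota (tau ^+ i) ^+ N * c.
  set x := tau ^+ i; have x0 : x != 0 by rewrite expf_neq0.
  pose t (i : 'I_n) := if i \in S then x else 1.
  have t0 j : t j != 0 by rewrite /t; case: ifP => // _; rewrite oner_eq0.
  have := peval_plucker_ideal iota M (finv t t0).
  rewrite /peval mmapB mmapZ => /eqP; rewrite subr_eq0 => /eqP.
  rewrite -!/(peval _ _ _) -/c peval_pullback torus_mx1 det_diag => E.
  rewrite -horner_evalE /q.
  rewrite (rmorph_mmap (horner_eval (iota x) : {rmorphism {poly K} -> K})).
  transitivity (iota (\prod_j (\row_i t i) 0 j) ^+ (k %/ n * d) * c); last first.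
    rewrite /N (exprM _ #|S|); congr (_ ^+ _ * _).
    rewrite -rmorphXn -prodr_const [in RHS]big_mkcond /=; congr (iota _).
    by apply: eq_bigr => j _; rewrite mxE.
  rewrite -rmorphXn -E; apply: eq_mmap => [y|I] /=.
    by rewrite /horner_eval hornerC.
  rewrite /horner_eval hornerM hornerXn hornerC (bigD1 I)//= big1 ?addr0.
    rewrite pidx_det_diag ?eqxx ?mulr1n => [|u v uv]; last first.
      by rewrite mxE (negbTE uv).
    congr (_ * _); rewrite -rmorphXn; congr (iota _).
    rewrite /a -prodr_const [in LHS]big_mkcond /=.
    by apply: eq_bigr => j _; rewrite !mxE eqxx mulr1n.
  move=> J JI; rewrite pidx_det_diag => [|u v uv]; last by rewrite mxE (negbTE uv).
  by rewrite eq_sym (negbTE JI) rmorph0 mul0r.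
(* The two polynomials agree at infinitely many points. The coefficient of degree [N] then keeps
   only the monomials of weight [N]. *)
have qE : q = 'X^N * c%:P.
  apply/eqP; rewrite -subr_eq0; set Q := q - _.
  apply/eqP/(@roots_geq_poly_eq0 _ Q
    [seq iota (tau ^+ i) | i <- seq.iota 0 (size Q)]).
  - apply/allP => _ /mapP[i _ ->].
    by rewrite /root /Q hornerD hornerN hornerM hornerXn hornerC qtau subrr.
  - by rewrite map_inj_uniq ?iota_uniq// => i j /fmorph_inj/htau.
  - by rewrite size_map size_iota.
have cE : c = \sum_(m <- msupp f) iota (mcoeff m f) *
    ((\prod_I plucker M I ^+ m I) *+ (N == \sum_I a I * m I)%N).
  have -> : c = q`_N by rewrite qE coefMC coefXn eqxx mul1r.
  rewrite /q /mmap coef_sum; apply: eq_bigr => m _ /=.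
  rewrite coefCM; congr (_ * _); rewrite /mmap1.
  rewrite (eq_bigr (fun I => 'X^(a I * m I) * (plucker M I ^+ m I)%:P));
    last by move=> I _; rewrite exprMn -exprM -rmorphXn.
  rewrite big_split /= prodrXr -rmorph_prod coefMC coefXn mulrC mulr_natr.
  by congr (_ *+ _); rewrite eq_sym.
have /(snorm_sum_ge hs ltr01)[m /andP[mf _]] : 1 <= s (\sum_(m <- msupp f)
    iota (mcoeff m f) *
    ((\prod_I plucker M I ^+ m I) *+ (N == \sum_I a I * m I)%N)).
  by rewrite -cE fM.
have [NE|_] := eqVneq N (\sum_I a I * m I)%N; last first.
  by rewrite mulr0n mulr0 (snorm0 hs) lt_geF.
rewrite mulr1n (snormM hs) (snorm_prod hs) => m1.
have mk : (\sum_I m I)%N = k by rewrite -mdegE; apply: (dhomog_mf fk).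
have pm I : s (plucker M I ^+ m I) = 1.
  apply: le_anti; rewrite (snormX hs) exprn_ile1 ?p1 ?(snorm_ge0 hs)//=.
  apply: le_trans m1 _; rewrite (bigD1 I)//= mulrCA -(snormX hs) ler_piMr//.
    exact: snorm_ge0.
  rewrite mulr_ile1 ?(snorm_ge0 hs) ?f1//.
    by apply: prodr_ge0 => J _; apply: snorm_ge0.
  apply: prodr_ile1 => J _; rewrite (snormX hs) exprn_ge0 ?(snorm_ge0 hs)//=.
  by rewrite exprn_ile1 ?p1 ?(snorm_ge0 hs).
(* Otherwise every Pluecker coordinate occurring in [m] has weight below [d * #|S| / n], so the
   total weight of [m] is below [N]. *)
apply: contrapT => /forall2NP h.
have lt : (\sum_I m I * (n * a I) < \sum_I m I * (d * #|S|))%N.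
  have [I0 mI0] : exists I, (0 < m I)%N.
    apply: contrapT => /forallNP m0; move: k0; rewrite -mk big1// => I _.
    by apply/eqP; rewrite -leqn0 leqNgt; apply/negP/m0.
  have aI I : (0 < m I)%N -> (n * a I < d * #|S|)%N.
    move=> mI; case: (h I) => [[]|/negP]; last by rewrite -ltnNge.
    move: (pm I); rewrite (snormX hs) => /eqP.
    by rewrite pexpr_eq1 ?(snorm_ge0 hs)// => /eqP.
  rewrite (bigD1 I0)//= [ltnRHS](bigD1 I0)//= -addSn leq_add//.
    by rewrite ltn_pmul2l// aI.
  apply: leq_sum => I _; have [->//|mI] := posnP (m I).
  by rewrite leq_mul2l ltnW ?orbT// aI.
move: lt; rewrite -big_distrl /= mk.
rewrite (eq_bigr (fun I => n * (a I * m I))%N) => [|I _]; last first.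
  by rewrite mulnC mulnA.
rewrite -big_distrr /= -NE /N.
have e : (n * (#|S| * (k %/ n * d)) = k %/ n * n * (d * #|S|))%N.
  by rewrite -[RHS]mulnA [RHS]mulnCA [X in (n * X)%N]mulnC -mulnA.
by rewrite e divnK// ltnn.
Qed.

(** * Linear forms on the Pluecker space *)

(** Sorting an injective [e] gives a Pluecker coordinate up to the sign of the sorting permutation;
    a repeated row makes the minor zero. *)
Lemma minor_form n d (F : fieldType) (e : 'I_d -> 'I_n) :
  exists2 L : polyring n d F, homog 1 L &
    forall (A : comNzRingType) (iota : {rmorphism F -> A}) (M : 'M[A]_(n, d)),
      peval iota (plucker M) L = \det (rowsub e M).
Proof.
have [/injectiveP inj|/injectivePn[i [j ij eij]]] := boolP (injectiveb e).
  have [I [t te]] := injective_pidx inj.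
  exists ((-1) ^+ t *: pvar F I).
    apply/dhomogZ; rewrite -[_ \in _]/(mpolyX F (mnm1 I) \is ishomog1 1 (@mdeg _)).
    by rewrite dhomogX; apply/eqP; exact: mdeg1.
  move=> A iota M; rewrite /peval mmapZ /pvar mmapX mmap1U rmorph_sign -det_perm.
  rewrite -det_mulmx -row_permE; congr (\det _).
  by apply/matrixP => a b; rewrite !mxE te.
exists 0; first exact: dhomog0.
move=> A iota M; rewrite /peval mmap0.
by rewrite (determinant_alternate ij)// => b; rewrite !mxE eij.
Qed.

Lemma lform_subproof n d (F : fieldType) (h : 'M[F]_n) (f : 'I_d -> 'I_n) :
  exists L : polyring n d F, homog 1 L /\
    forall (A : comNzRingType) (iota : {rmorphism F -> A}) (M : 'M[A]_(n, d)),
      peval iota (plucker M) L = \det (rowsub f (map_mx iota h *m M)).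
Proof.
exists (\sum_(e : {ffun 'I_d -> 'I_n}) (\prod_j h (f j) (e j)) *:
  s2val (cid2 (minor_form F e))); split.
  by apply: rpred_sum => e _; apply/dhomogZ; case: (cid2 _).
move=> A iota M; rewrite /peval raddf_sum det_rowsub_mul; apply: eq_bigr => e _.
rewrite /= mmapZ rmorph_prod; congr (_ * _).
  by apply: eq_bigr => j _; rewrite mxE.
by case: (cid2 _) => L /= _ hL; exact: hL.
Qed.

(** For [h = invmx g] this is the Pluecker coordinate [f] with respect to the basis of columns of
    [g]. It is determined modulo the Pluecker ideal. *)
Definition lform n d (F : fieldType) (h : 'M[F]_n) (f : 'I_d -> 'I_n) :
  polyring n d F := sval (cid (lform_subproof h f)).

Lemma lform_homog n d (F : fieldType) (h : 'M[F]_n) (f : 'I_d -> 'I_n) :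
  homog 1 (lform h f).
Proof. by rewrite /lform; case: (cid _) => L /= []. Qed.

Lemma peval_lform n d (F : fieldType) (h : 'M[F]_n) (f : 'I_d -> 'I_n)
    (A : comNzRingType) (iota : {rmorphism F -> A}) (M : 'M[A]_(n, d)) :
  peval iota (plucker M) (lform h f) = \det (rowsub f (map_mx iota h *m M)).
Proof. by rewrite /lform; case: (cid _) => L /= [_]; exact. Qed.

Lemma lform_mul_ideal n d (F : fieldType) (h h' : 'M[F]_n) (f : 'I_d -> 'I_n) :
  plucker_ideal (lform (h *m h') f -
    \sum_(e : {ffun 'I_d -> 'I_n}) (\prod_j h (f j) (e j)) *: lform h' e).
Proof.
rewrite /plucker_ideal /peval mmapB; apply/eqP; rewrite subr_eq0; apply/eqP.
rewrite -/(peval _ _ _) peval_lform map_mxM -mulmxA det_rowsub_mul raddf_sum.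
apply: eq_bigr => e _; rewrite /= mmapZ rmorph_prod -/(peval _ _ _) peval_lform.
by congr (_ * _); apply: eq_bigr => j _; rewrite mxE.
Qed.

(** * Points of the analytification as seminorms *)

Section BerkSeminorm.
Variables (R : realType) (F : fieldType) (abs : F -> R) (n d : nat).
Hypothesis habs : nonarch_abs abs.

Lemma cone_seminorm (x : cone abs n d) : seminorm (sval x).
Proof.
case: x => x [[x0 xC xM xD] _ _] /=; have hs := nonarch_abs_seminorm habs.
split=> //; first by rewrite -(mpolyC0 (pdim n d) F) xC (snorm0 hs).
by rewrite -(mpolyC1 (pdim n d) F) xC (snorm1 hs).
Qed.

Lemma berk_seminorm (x : berk abs n d) : seminorm (berk_val x).
Proof. exact: cone_seminorm. Qed.

Lemma berk_valZ (x : berk abs n d) c (f : polyring n d F) :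
  berk_val x (c *: f) = abs c * berk_val x f.
Proof.
rewrite /berk_val; case: (generic_quotient.repr x) => /= y [[_ yC yM _] _ _].
by rewrite -mul_mpolyC yM yC.
Qed.

Lemma berk_val_ideal (x : berk abs n d) f : plucker_ideal f -> berk_val x f = 0.
Proof. by rewrite /berk_val; case: (generic_quotient.repr x) => /= y [_ yI _] /yI. Qed.

Lemma berk_val_lform_mul (x : berk abs n d) (h h' : 'M[F]_n) (f : 'I_d -> 'I_n) :
  berk_val x (lform (h *m h') f) =
  berk_val x
    (\sum_(e : {ffun 'I_d -> 'I_n}) (\prod_j h (f j) (e j)) *: lform h' e).
Proof.
by apply: (snorm_eq_mod (berk_seminorm x)); apply/berk_val_ideal/lform_mul_ideal.
Qed.

(* Homogeneity makes the condition independent of the representative of [x]. *)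
Lemma open_berk_lt k (f h : polyring n d F) (a b : R) :
  homog k f -> homog k h ->
  open [set x : berk abs n d | a * berk_val x f < b * berk_val x h].
Proof.
move=> fk hk.
have repr_pi (y : cone abs n d) : exists2 c : R, 0 < c &
    forall k f, homog k f -> sval y f = c ^+ k * berk_val (\pi_(berk abs n d) y) f.
  have /eqmodP/asboolP : generic_quotient.repr (\pi_{eq_quot cone_equiv abs n d} y) =
      y %[mod {eq_quot cone_equiv abs n d}]%qT by rewrite reprK.
  by [].
have ctsv g : continuous (fun y : cone abs n d => sval y g).
  move=> y; apply: (@continuous_comp _ {ptws polyring n d F -> R} _
    (fun y : cone abs n d => sval y) (fun v => v g)).
    exact: initial_continuous.
  exact: (@proj_continuous _ (fun=> R) g).
rewrite /open /= /quotient_open.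
rewrite (_ : _ @^-1` _ = [set y : cone abs n d | 0 < b * sval y h - a * sval y f]).
  apply: (@open_comp _ _ (fun y : cone abs n d => b * sval y h - a * sval y f)
    [set r | 0 < r]); last exact: open_gt.
  have ctsM c g : continuous (fun y : cone abs n d => c * sval y g).
    move=> y; apply: (@continuousM R (cone abs n d) (cst c)).
      exact: cst_continuous.
    exact: ctsv.
  by move=> y _; apply: (@continuousB R R (cone abs n d)); apply: ctsM.
have eqv (y : cone abs n d) : (0 < b * sval y h - a * sval y f) =
    (a * berk_val (\pi_(berk abs n d) y) f <
     b * berk_val (\pi_(berk abs n d) y) h).
  have [c c0 hc] := repr_pi y.
  rewrite (hc _ _ fk) (hc _ _ hk) 2!(mulrCA _ (c ^+ k)) subr_gt0.
  by rewrite ltr_pM2l ?exprn_gt0.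
by apply/seteqP; split=> y /=; rewrite eqv.
Qed.

End BerkSeminorm.

(** * Norms and apartments *)

Section BasisNorm.
Variables (R : realType) (F : fieldType) (abs : F -> R) (pi : F) (n : nat).
Hypothesis habs : nonarch_abs abs.
Hypothesis pi_gt0 : 0 < abs pi.

Let hs := nonarch_abs_seminorm habs.
Let pi_neq0 : abs pi != 0 := lt0r_neq0 pi_gt0.

Local Notation bnorm := (basis_norm abs pi).
Implicit Types (g h : 'M[F]_n) (a b : 'I_n -> R).

Lemma basis_norm_shift g a c w :
  bnorm g (fun i => a i + c) w = abs pi `^ c * bnorm g a w.
Proof.
rewrite /basis_norm (big_endo ( *%R (abs pi `^ c))).
- by apply: eq_bigr => i _; rewrite powRD ?pi_neq0 ?implybT// mulrA mulrC.
- by move=> x y; rewrite maxr_pMr// powR_ge0.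
- exact: mulr0.
Qed.

Lemma basis_norm_col g a j :
  g \in unitmx -> bnorm g a (g *m delta_mx j 0) = abs pi `^ a j.
Proof.
move=> gu; rewrite /basis_norm mulKmx//; apply: le_anti; apply/andP; split.
  apply: bigmax_le => [|i _]; first exact: powR_ge0.
  rewrite mxE eqxx andbT; case: eqP => [->|_].
    by rewrite (snorm1 hs) mul1r.
  by rewrite (snorm0 hs) mul0r powR_ge0.
apply: le_trans (le_bigmax _ _ j).
by rewrite mxE !eqxx (snorm1 hs) mul1r.
Qed.

Lemma basis_norm_entry g a g' a' i j :
  g \in unitmx -> bnorm g a =1 bnorm g' a' ->
  abs ((invmx g' *m g) i j) * abs pi `^ a' i <= abs pi `^ a j.
Proof.
move=> gu e; rewrite -(basis_norm_col a j gu) e /basis_norm.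
apply: le_trans (le_bigmax _
  (fun i => abs ((invmx g' *m (g *m delta_mx j 0)) i 0) * abs pi `^ a' i) i).
by rewrite mulmxA -colE [col _ _ _ _]mxE.
Qed.

(** By the ultrametric inequality it suffices to compare the two norms on the columns of [g]. *)
Lemma le_basis_norm g a g' a' w : g \in unitmx ->
  (forall i j, abs ((invmx g' *m g) i j) * abs pi `^ a' i <= abs pi `^ a j) ->
  bnorm g' a' w <= bnorm g a w.
Proof.
move=> gu le.
have bn0 : 0 <= bnorm g a w by exact: bigmax_ge_id.
apply: bigmax_le => // i _.
have -> : invmx g' *m w = invmx g' *m g *m (invmx g *m w).
  by rewrite -mulmxA mulKVmx.
rewrite mxE -ler_pdivlMr ?powR_gt0//.
apply: (snorm_sum_le hs) => [|j _].
  by apply: divr_ge0 => //; exact: powR_ge0.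
rewrite (snormM hs) ler_pdivlMr ?powR_gt0// mulrAC.
apply: (@le_trans _ _ (abs ((invmx g *m w) j 0) * abs pi `^ a j)).
  by rewrite mulrC ler_wpM2l// (snorm_ge0 hs).
exact: (le_bigmax _ (fun i => abs ((invmx g *m w) i 0) * abs pi `^ a i)).
Qed.

Lemma eq_basis_norm g a g' a' : g \in unitmx -> g' \in unitmx ->
  (forall i j, abs ((invmx g' *m g) i j) * abs pi `^ a' i <= abs pi `^ a j) ->
  (forall i j, abs ((invmx g *m g') i j) * abs pi `^ a i <= abs pi `^ a' j) ->
  bnorm g a =1 bnorm g' a'.
Proof.
by move=> gu g'u le le' w; apply: le_anti; rewrite !le_basis_norm.
Qed.

(** As [v *m u = 0], the matrix [u *m v] has square zero and [1 - u *m v] inverts [1 + u *m v]. By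
    the bound neither increases the norm, so the norm is preserved. *)
Lemma basis_norm_transvection g a (u : 'cV[F]_n) (v : 'rV[F]_n) :
  g \in unitmx -> v *m u = 0 ->
  (forall k l, abs (u k 0 * v 0 l) * abs pi `^ a k <= abs pi `^ a l) ->
  [/\ g *m (1%:M + u *m v) \in unitmx,
      invmx (g *m (1%:M + u *m v)) = (1%:M - u *m v) *m invmx g
    & bnorm (g *m (1%:M + u *m v)) a =1 bnorm g a].
Proof.
move=> gu vu le.
have uv2 : u *m v *m (u *m v) = 0 by rewrite mulmxA -(mulmxA u) vu mulmx0 mul0mx.
have inv1 : (1%:M - u *m v) *m (1%:M + u *m v) = 1%:M.
  by rewrite mulmxDl mul1mx mulNmx mulmxDr mulmx1 uv2 addr0 addrK.
have [_ Eu] := mulmx1_unit inv1.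
have gEu : g *m (1%:M + u *m v) \in unitmx by rewrite unitmx_mul gu.
have inv2 : (1%:M - u *m v) *m invmx g *m (g *m (1%:M + u *m v)) = 1%:M.
  by rewrite -mulmxA mulKmx.
have invE : invmx (g *m (1%:M + u *m v)) = (1%:M - u *m v) *m invmx g.
  by have := mulmxK gEu ((1%:M - u *m v) *m invmx g); rewrite inv2 mul1mx.
have le1 (e : F) k l : abs e = 1 ->
    abs ((1%:M + e *: (u *m v)) k l) * abs pi `^ a k <= abs pi `^ a l.
  move=> e1; rewrite !mxE big_ord1 -ler_pdivlMr ?powR_gt0//.
  apply: le_trans (snormD hs _ _) _; rewrite ge_max !ler_pdivlMr ?powR_gt0//.
  rewrite (snormM hs e) e1 mul1r le andbT.
  by case: eqP => [->|_]; rewrite ?(snorm1 hs) ?mul1r// (snorm0 hs) mul0r powR_ge0.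
split=> //; apply: eq_basis_norm => // i j.
  rewrite mulmxA mulVmx// mul1mx -[u *m v]scale1r.
  by apply: le1; rewrite (snorm1 hs).
rewrite invE -mulmxA mulVmx// mulmx1 -scaleN1r.
by apply: le1; rewrite (snormN1 hs).
Qed.

(** Row operations clear the pivot column by changing [g], and column operations clear the pivot row
    by changing [g']. They preserve the norms because the pivot is largest in its column and in its
    row, relative to the two norms. *)
Lemma pivot_step g a g' a' h i0 j0 : invmx g *m g' = h ->
  g \in unitmx -> g' \in unitmx -> h i0 j0 != 0 ->
  (forall k, abs (h k j0) * abs pi `^ a k <= abs (h i0 j0) * abs pi `^ a i0) ->
  (forall l, abs (h i0 l) * abs pi `^ a' j0 <= abs (h i0 j0) * abs pi `^ a' l) ->
  exists g1 g1', [/\ [/\ g1 \in unitmx & g1' \in unitmx],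
    bnorm g1 a =1 bnorm g a, bnorm g1' a' =1 bnorm g' a'
    & forall k l, (invmx g1 *m g1') k l =
        if k == i0 then h i0 j0 *+ (l == j0)
        else h k l - h k j0 * h i0 l / h i0 j0].
Proof.
move=> hE gu g'u h0 hr hc; have absh0 := snorm_gt0 hs h0.
pose u : 'cV[F]_n := \col_k (if k == i0 then 0 else h k j0 / h i0 j0).
pose u' : 'rV[F]_n := delta_mx 0 i0.
pose v : 'cV[F]_n := delta_mx j0 0.
pose v' : 'rV[F]_n := \row_l (if l == j0 then 0 else - (h i0 l / h i0 j0)).
have [||g1u g1V g1E] := @basis_norm_transvection g a u u' gu.
- by rewrite -rowE; apply/rowP => j; rewrite !mxE eqxx.
- move=> k l; rewrite !mxE eqxx /=; have [->|_] := eqVneq l i0; last first.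
    by rewrite mulr0 (snorm0 hs) mul0r powR_ge0.
  rewrite mulr1; case: ifP => [_|_]; first by rewrite (snorm0 hs) mul0r powR_ge0.
  by rewrite (snormM hs) (snormV hs) mulrAC ler_pdivrMr// [leRHS]mulrC hr.
have [||g1'u g1'V g1'E] := @basis_norm_transvection g' a' v v' g'u.
- by rewrite -colE; apply/colP => j; rewrite !mxE eqxx.
- move=> k l; rewrite !mxE eqxx andbT; have [->|_] := eqVneq k j0; last first.
    by rewrite mul0r (snorm0 hs) mul0r powR_ge0.
  rewrite mul1r; case: ifP => [_|_]; first by rewrite (snorm0 hs) mul0r powR_ge0.
  by rewrite (snormN hs) (snormM hs) (snormV hs) mulrAC ler_pdivrMr// [leRHS]mulrC hc.
exists (g *m (1%:M + u *m u')), (g' *m (1%:M + v *m v')); split=> // k l.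
rewrite g1V -mulmxA (mulmxA (invmx g)) hE mulmxDr mulmx1 mulmxA.
rewrite mulmxBl mul1mx -(mulmxA u) -rowE.
set X := h + _; have XE k' l' : X k' l' = h k' l' + h k' j0 * v' 0 l'.
  by rewrite /X -(colE j0 h) !mxE big_ord1 !mxE.
move: X XE => X XE.
have -> : (X - u *m row i0 X) k l = X k l - u k 0 * X i0 l.
  by rewrite !mxE big_ord1 !mxE.
rewrite !XE !mxE; have [->|_] := eqVneq k i0.
  rewrite mul0r subr0; have [->|_] := eqVneq l j0; first by rewrite mulr0 addr0.
  by rewrite mulrN mulrC divfK// subrr.
by field.
Qed.

Let monomial_row h i j := [/\ h i j != 0, forall l, l != j -> h i l = 0
  & forall k, k != i -> h k j = 0].

(* Gaussian elimination, the pivot being chosen such that the row and column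
   operations preserve the two norms. *)
Lemma gaussian_elimination g a g' a' : g \in unitmx -> g' \in unitmx ->
  exists g1 g1', [/\ [/\ g1 \in unitmx & g1' \in unitmx],
    bnorm g1 a =1 bnorm g a, bnorm g1' a' =1 bnorm g' a'
    & forall i, exists j, monomial_row (invmx g1 *m g1') i j].
Proof.
move Dk : #|[pred i | ~~ `[< exists j, monomial_row (invmx g *m g') i j >]]| => k.
elim/ltn_ind: k g g' Dk => k IH g g' Dk gu g'u; set h := invmx g *m g' in Dk.
have [k0|k0] := posnP k.
  exists g, g'; split=> // i; apply: contrapT => /asboolPn hi.
  by have := card0_eq (etrans Dk k0) i; rewrite !inE hi.
have /card_gt0P[i1 hi1] : (0 < #|[pred i | ~~ `[< exists j, monomial_row h i j >]]|)%N.
  by rewrite Dk.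
have hu : h \in unitmx by rewrite unitmx_mul unitmx_inv gu.
have [j1 hij1] : exists j, h i1 j != 0.
  apply: contrapT => /forallNP h0.
  have r0 : row i1 h = 0.
    by apply/rowP => j; rewrite [RHS]mxE [LHS]mxE; apply/eqP/negPn/negP/h0.
  have := row_mul i1 h (invmx h); rewrite r0 mul0mx mulmxV// => /rowP/(_ i1).
  by rewrite !mxE eqxx => /eqP; rewrite oner_eq0.
(* The size of an entry relative to the two norms. The pivot maximizes it over the rows that are not
   yet monomial. *)
pose wt (ij : 'I_n * 'I_n) := abs (h ij.1 ij.2) * abs pi `^ a ij.1 / abs pi `^ a' ij.2.
pose P (ij : 'I_n * 'I_n) := ~~ `[< exists j, monomial_row h ij.1 j >].
pose p := [arg max_(ij > (i1, j1) | P ij) wt ij]%O.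
have [Pp pmax] : P p /\ forall ij, P ij -> wt ij <= wt p.
  by rewrite /p; case: arg_maxP.
move: p Pp pmax => [i0 j0]; rewrite /P /wt /= => /asboolPn ndone pmax.
have wt1 : 0 < abs (h i1 j1) * abs pi `^ a i1 / abs pi `^ a' j1.
  by rewrite divr_gt0 ?mulr_gt0 ?powR_gt0// (snorm_gt0 hs).
have h0 : h i0 j0 != 0.
  apply/eqP => h0; have := lt_le_trans wt1 (pmax (i1, j1) hi1).
  by rewrite h0 (snorm0 hs) !mul0r ltxx.
have [||g1 [g1' [[g1u g1'u] g1E g1'E h1E]]] :=
  pivot_step (a := a) (a' := a') (erefl h) gu g'u h0.
(* A row that is already monomial vanishes in the pivot column, so the pivot is maximal in its whole
   column. *)
- move=> k'; have [/asboolP[j [hkj hr hc]]|nd] :=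
    boolP `[< exists j, monomial_row h k' j >]; last first.
    by have := pmax (k', j0) nd; rewrite ler_pM2r ?invr_gt0 ?powR_gt0.
  have [jj|jj] := eqVneq j0 j; last first.
    by rewrite hr// (snorm0 hs) mul0r mulr_ge0 ?powR_ge0 ?(snorm_ge0 hs).
  have [->//|ik] := eqVneq i0 k'.
  by case/eqP: h0; rewrite jj hc.
- move=> l; have := pmax (i0, l) (introN (asboolP _) ndone).
  rewrite /= ler_pdivrMr ?powR_gt0// mulrAC ler_pdivlMr ?powR_gt0//.
  by rewrite -!mulrA ![abs pi `^ a i0 * _]mulrC !mulrA ler_pM2r ?powR_gt0.
have [|g2 [g2' [gu2 g2E g2'E hh]]] := IH _ _ g1 g1' erefl g1u g1'u; last first.
  exists g2, g2'; split=> //; first by move=> w; rewrite g2E.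
  by move=> w; rewrite g2'E.
rewrite -Dk; apply: proper_card; apply/fintype.properP; split.
  apply/fintype.subsetP => i; rewrite !inE; apply: contra => /asboolP[j [hij hr hc]].
  have ii : i != i0 by apply/eqP => e; apply: ndone; exists j; rewrite -e.
  have jj : j != j0 by apply/eqP => e; case/eqP: h0; rewrite -e hc// eq_sym.
  have hi0 : h i j0 = 0 by rewrite hr// eq_sym.
  have h0j : h i0 j = 0 by rewrite hc// eq_sym.
  apply/asboolP; exists j; split=> [|l lj|k' ki].
  - by rewrite h1E (negbTE ii) hi0 mul0r mul0r subr0.
  - by rewrite h1E (negbTE ii) hi0 mul0r mul0r subr0 hr.
  - rewrite h1E; case: eqP => [_|_]; first by rewrite (negbTE jj).
    by rewrite h0j mulr0 mul0r subr0 hc.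
exists i0; rewrite !inE; first exact/asboolPn.
apply/negPn/asboolP; exists j0; split=> [|l lj|k' ki].
- by rewrite h1E !eqxx.
- by rewrite h1E eqxx (negbTE lj).
- by rewrite h1E (negbTE ki) mulfK ?subrr.
Qed.

(** Once the transition matrix is monomial, the two bases agree up to order and scaling, so both
    norms are diagonal in one of them. *)
Lemma common_apartment g a g' a' : abs pi != 1 ->
  g \in unitmx -> g' \in unitmx ->
  exists g1 b, [/\ g1 \in unitmx, bnorm g1 a =1 bnorm g a
    & bnorm g1 b =1 bnorm g' a'].
Proof.
move=> pi1 gu g'u.
have [g1 [g1' [[g1u g1'u] g1E g1'E hrow]]] := gaussian_elimination a a' gu g'u.
set h := invmx g1 *m g1' in hrow; have [j hj] := choice hrow.
have lnpi : ln (abs pi) != 0 by rewrite ln_eq0.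
(* The column [j i] of [g1'] is the column [i] of [g1] times [h i (j i)]; [b i] accounts for the
   size of this factor. *)
pose b i := a' (j i) - ln (abs (h i (j i))) / ln (abs pi).
have bE i : abs (h i (j i)) * abs pi `^ b i = abs pi `^ a' (j i).
  have [hi _ _] := hj i; have h0 := snorm_gt0 hs hi.
  rewrite powRB ?pi_neq0 ?implybT// mulrCA -[RHS]mulr1; congr (_ * _).
  rewrite [X in _ / X](_ : _ = abs (h i (j i))) ?divff ?gt_eqF//.
  by rewrite /powR gt_eqF// divfK// lnK.
exists g1, b; split=> //; suff e : bnorm g1 b =1 bnorm g1' a' by move=> w; rewrite e.
apply: eq_basis_norm => // k l; last first.
  have [->|lk] := eqVneq l (j k); first by rewrite bE.
  by have [_ h0 _] := hj k; rewrite h0// (snorm0 hs) mul0r powR_ge0.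
have hV : invmx g1' *m g1 *m h = 1%:M by rewrite -mulmxA mulKVmx// mulVmx.
have [hl _ hc] := hj l.
have /matrixP/(_ k (j l)) := hV; rewrite mxE (bigD1 l)//= big1 ?addr0 => [e|i il].
  rewrite -(ler_pM2r (snorm_gt0 hs hl)) mulrAC -(snormM hs) e mxE [leRHS]mulrC bE.
  have [->|_] := eqVneq k (j l); first by rewrite (snorm1 hs) mul1r.
  by rewrite (snorm0 hs) mul0r powR_ge0.
by rewrite hc ?mulr0.
Qed.

End BasisNorm.

(** * Finiteness of the residue field *)

Lemma expr_small (R : realType) (x e : R) :
  0 <= x < 1 -> 0 < e -> exists k, x ^+ k <= e.
Proof.
move=> /andP[x0 x1] e0.
have /cvgrPdist_le/(_ e e0)[k _ hk] : (fun k => x ^+ k) @ \oo --> (0 : R).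
  by apply: cvg_expr; rewrite ger0_norm.
exists k; have := hk k (leqnn k).
by rewrite /= sub0r normrN ger0_norm// exprn_ge0.
Qed.

Section IntegerValues.
Variables (R : realType) (K : fieldType) (s : K -> R) (p : nat).
Hypotheses (hs : seminorm s) (hp : prime p) (sp : s p%:R < 1).

Lemma snorm_nat_le1 k : s k%:R <= 1.
Proof.
elim: k => [|k IH]; first by rewrite (snorm0 hs).
by rewrite -nat1r; apply: le_trans (snormD hs _ _) _; rewrite (snorm1 hs) ge_max lexx.
Qed.

Lemma snorm_int_le1 (z : int) : s z%:~R <= 1.
Proof.
by case: z => k; rewrite ?NegzE ?rmorphN ?(snormN hs) /= snorm_nat_le1.
Qed.

Lemma snorm_dvd_lt1 k : (p %| k)%N -> s k%:R < 1.
Proof.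
move=> /dvdnP[q ->]; rewrite natrM (snormM hs).
by apply: le_lt_trans sp; rewrite ler_piMl ?snorm_nat_le1// (snorm_ge0 hs).
Qed.

(** Bezout gives an [a] for which [p] divides [1 + a * k], so [a * k] has size 1, while both factors
    have size at most 1. *)
Lemma snorm_coprime k : ~~ (p %| k)%N -> s k%:R = 1.
Proof.
move=> npk; have cop : coprime p k by rewrite prime_coprime.
have [a _ pa] := Bezoutl k (prime_gt0 hp).
move: pa; rewrite (eqP cop) => /snorm_dvd_lt1; rewrite natrD => lt.
apply: le_anti; rewrite snorm_nat_le1 /=.
have : s 1 <= s (a * k)%:R.
  have e : s (- (a * k)%:R) = s 1.
    by apply: snorm_close => //; rewrite opprK (snorm1 hs).
  by rewrite -e (snormN hs).
rewrite (snorm1 hs) natrM (snormM hs) => /le_trans; apply.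
by rewrite ler_piMl ?snorm_nat_le1// (snorm_ge0 hs).
Qed.

End IntegerValues.

(** Some rational number [q] lies at distance less than 1 from [x]; its denominator is prime to [p],
    and its residue modulo [p] is the digit. *)
Lemma padic_digit (R : realType) (p : nat) (Qp : fieldType) (abs : Qp -> R) :
  padic_numbers p abs -> forall x, abs x <= 1 ->
  exists2 k, (k < p)%N & abs (x - k%:R) < 1.
Proof.
move=> [hp habs absp _ dense] x x1.
have hs := nonarch_abs_seminorm habs.
have p1 : abs p%:R < 1 by rewrite absp invf_lt1 ?ltr1n ?prime_gt1// ltr0n prime_gt0.
have [q hq] := dense x 1 ltr01.
have q1 : abs (ratr q) <= 1.
  have := snormB hs x (x - ratr q); rewrite opprB addrC subrK => /le_trans; apply.
  by rewrite ge_max x1 ltW.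
suff [k kp hk] : exists2 k, (k < p)%N & abs (ratr q - k%:R) < 1.
  exists k => //; rewrite -(subrKA (ratr q)).
  by apply: le_lt_trans (snormD hs _ _) _; rewrite gt_max hq.
pose D := `|denq q|%N.
have DE : (denq q)%:~R = D%:R :> Qp by rewrite -[denq q]absz_denq.
(* If the denominator is 0 in [Qp], so is [ratr q], as the inverse of 0 is 0. *)
have [D0|D0] := eqVneq (D%:R : Qp) 0.
  exists 0%N; rewrite ?prime_gt0//.
  by rewrite /ratr DE D0 invr0 mulr0 subr0 (snorm0 hs).
have ratE : ratr q * D%:R = (numq q)%:~R :> Qp by rewrite /ratr DE divfK.
have nD : ~~ (p %| D)%N.
  apply/negP => pD; have nN : ~~ (p %| `|numq q|)%N.
    apply/negP => pN; have := coprime_num_den q; rewrite /coprime -/D => /eqP cND.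
    by have := dvdn_gcd p `|numq q| D; rewrite pN pD cND dvdn1 => /eqP e; rewrite e in hp.
  have := snorm_coprime hs hp p1 nN.
  have <- : abs (numq q)%:~R = abs `|numq q|%:R.
    by case: (numq q) => m //=; rewrite NegzE rmorphN (snormN hs).
  rewrite -ratE (snormM hs) => e.
  have := snorm_dvd_lt1 hs p1 pD; rewrite ltNge -e => /negP; apply.
  by rewrite ler_piMl// (snorm_ge0 hs).
have D1 := snorm_coprime hs hp p1 nD.
have [a _] := Bezoutl D (prime_gt0 hp).
have -> : gcdn p D = 1%N by apply/eqP; rewrite -/(coprime _ _) prime_coprime.
(* [a] is minus the inverse of the denominator modulo [p], so [z] is congruent to [q]. *)
move=> pa; pose z := (- (numq q * a%:Z))%R.
have p0 : (p%:Z != 0)%R by rewrite -lt0n prime_gt0.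
pose k := `|(z %% p%:Z)%Z|%N.
have kE : (k%:Z = (z %% p%:Z)%Z)%R by rewrite /k gez0_abs// modz_ge0.
exists k.
  by rewrite -ltz_nat kE; have := ltz_mod z p0; rewrite /= gtr0_norm // ltz_nat prime_gt0.
have e : (ratr q - k%:R) * D%:R =
    (numq q)%:~R * (1 + a * D)%:R + p%:R * ((z %/ p%:Z)%Z * D%:Z)%:~R :> Qp.
  have zE : z%:~R = (z %/ p%:Z)%Z%:~R * p%:R + k%:R :> Qp.
    by rewrite {1}(divz_eq z p%:Z) -kE rmorphD rmorphM.
  rewrite mulrBl ratE natrD natrM rmorphM /=.
  have -> : k%:R = - ((numq q)%:~R * a%:R) - (z %/ p%:Z)%Z%:~R * p%:R :> Qp.
    by rewrite -[k%:R](addKr ((z %/ p%:Z)%Z%:~R * p%:R)) -zE /z rmorphN rmorphM /= addrC.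
  by ring.
have : abs ((ratr q - k%:R) * D%:R) < 1.
  rewrite e; apply: le_lt_trans (snormD hs _ _) _; rewrite gt_max !(snormM hs).
  apply/andP; split.
    apply: le_lt_trans (snorm_dvd_lt1 hs p1 pa).
    by rewrite ler_piMl ?(snorm_ge0 hs)// snorm_int_le1.
  by apply: le_lt_trans p1; rewrite ler_piMr ?(snorm_ge0 hs)// snorm_int_le1.
by rewrite (snormM hs) D1 mulr1.
Qed.

Section FiniteNet.
Variables (R : realType) (p : nat) (Qp : fieldType) (absQ : Qp -> R).
Hypothesis hQp : padic_numbers p absQ.
Variables (F : fieldExtType Qp) (absF : F -> R).
Hypothesis habs : nonarch_abs absF.
Hypothesis hext : forall c : Qp, absF c%:A = absQ c.

Let hs := nonarch_abs_seminorm habs.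

Let hp : prime p. Proof. by have [] := hQp. Qed.

Let p1 : absF p%:R < 1.
Proof.
have [_ _ absp _ _] := hQp; rewrite -[p%:R](rmorph_nat (in_alg F)) /= hext absp.
by rewrite invf_lt1 ?ltr1n ?prime_gt1// ltr0n prime_gt0.
Qed.

(* The reductions of the [u i] are linearly independent over the prime field. *)
Let residually_free k (u : 'I_k -> F) :=
  (forall i, absF (u i) <= 1) /\
  forall c : 'I_k -> nat, (forall i, (c i < p)%N) ->
    absF (\sum_i (c i)%:R * u i) < 1 -> forall i, c i = 0%N.

(** A relation over [Qp], divided by its largest coefficient, gives a relation between the residues
    whose coefficients are digits, and the digit of 1 is not 0. *)
Let residually_free_dim k (u : 'I_k -> F) : residually_free u -> (k <= \dim {:F})%N.
Proof.
move=> [u1 hu]; pose X := [tuple u i | i < k].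
suff /eqP e : free X by rewrite -[k](size_tuple X) -e dimvS// subvf.
apply/freeP => q; under eq_bigr do rewrite -tnth_nth tnth_mktuple.
move=> q0; apply: contrapT => /existsNP[i1 /eqP qi1].
have hsQ : seminorm absQ by apply: nonarch_abs_seminorm; case: hQp.
pose i0 := [arg max_(i > i1) absQ (q i)]%O.
have i0P i : absQ (q i) <= absQ (q i0) by rewrite /i0; case: arg_maxP => // j _; exact.
have qi0 : 0 < absQ (q i0) by apply: lt_le_trans (i0P i1); apply: snorm_gt0.
have qi0N : q i0 != 0 by apply: contraTneq qi0 => ->; rewrite (snorm0 hsQ) ltxx.
have q1 i : absQ (q i / q i0) <= 1.
  by rewrite (snormM hsQ) (snormV hsQ) ler_pdivrMr// mul1r.
have /choice[c hc] : forall i, exists c, (c < p)%N /\ absQ (q i / q i0 - c%:R) < 1.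
  by move=> i; have [c cp hc] := padic_digit hQp (q1 i); exists c.
have /(_ _ i0) c0 := hu c (fun i => (hc i).1).
have := (hc i0).2; rewrite c0 ?subr0 ?divff// ?(snorm1 hsQ) ?ltxx//.
have -> : \sum_i (c i)%:R * u i = \sum_i ((c i)%:R - q i / q i0)%:A * u i.
  have e : \sum_i (q i / q i0)%:A * u i = 0.
    have := congr1 ( *:%R (q i0)^-1) q0; rewrite scaler0 scaler_sumr => q0'.
    rewrite -[RHS]q0'.
    apply: eq_bigr => i _.
    by rewrite mulr_algl scalerA mulrC.
  transitivity (\sum_i ((c i)%:R * u i - (q i / q i0)%:A * u i)).
    by rewrite sumrB e subr0.
  apply: eq_bigr => i _.
  by rewrite scalerBl mulrBl scaler_nat.
apply: contrapT => /negP; rewrite -leNgt => /(snorm_sum_ge hs ltr01)[i _].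
rewrite (snormM hs) hext => h.
have := (hc i).2; rewrite -(snormN hsQ) opprB ltNge => /negP; apply.
by apply: le_trans h _; rewrite ler_piMr// (snorm_ge0 hsQ).
Qed.

(** A residually free family is extended as long as possible. The degree of [F] over [Qp] bounds its
    length, and integral combinations of a maximal one form the net. *)
Lemma residue_net : exists s : seq F, forall y, absF y <= 1 ->
  exists2 y', y' \in s & absF (y - y') < 1.
Proof.
have step k : (exists u : 'I_k -> F, residually_free u) \/
    exists s : seq F, forall y, absF y <= 1 ->
      exists2 y', y' \in s & absF (y - y') < 1.
  elim: k => [|k [[u hu]|]]; [left| |by right].
    by exists (fun=> 0); split=> [[]|? _ _ []].
  pose ext y (i : 'I_k.+1) := oapp u y (unlift ord0 i).
  have extE (c : 'I_k.+1 -> nat) y : \sum_i (c i)%:R * ext y i =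
      (c ord0)%:R * y + \sum_(i < k) (c (lift ord0 i))%:R * u i.
    rewrite big_ord_recl /ext unlift_none; congr (_ + _).
    by apply: eq_bigr => i _; rewrite liftK.
  have [[y y1 hy]|/forall2NP hy] :=
      pselect (exists2 y, absF y <= 1 & residually_free (ext y)).
    by left; exists (ext y).
  (* The bound [p * p] leaves room for unreduced products of two residues. *)
  right; exists [seq \sum_i (f i)%:R * u i | f : {ffun 'I_k -> 'I_(p * p)}] => y y1.
  case: (hy y) => // /not_andP[[]|].
    move=> i; rewrite /ext; case: unliftP => [j _|_] //=; exact: hu.1.
  move=> /existsNP[c /not_implyP[cp /not_implyP[cy /existsNP[i /eqP ci]]]].
  rewrite extE in cy.
  have c0 : c ord0 != 0%N.
    apply: contra_neq ci => c0; case: (unliftP ord0 i) => [j ->|->] //.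
    apply: (hu.2 (fun j => c (lift ord0 j))) => [j'|]; first exact: cp.
    by move: cy; rewrite c0 mul0r add0r.
  (* [e] is minus the inverse of [c ord0] modulo [p], so the relation makes [y] congruent to [e]
     times the combination of the [u j]. *)
  have [e ep] := Bezoutl (c ord0) (prime_gt0 hp).
  have -> : gcdn p (c ord0) = 1%N.
    apply/eqP; rewrite -/(coprime _ _) prime_coprime//.
    by apply/negP => /dvdn_leq; rewrite lt0n => /(_ c0); rewrite leqNgt cp.
  move=> /(snorm_dvd_lt1 hs p1) e1.
  have ecp (j : 'I_k) : (e * c (lift ord0 j) < p * p)%N.
    rewrite -(ltn_pmul2r (prime_gt0 hp)) in ep; apply: leq_ltn_trans ep.
    by rewrite leq_mul2l ltnW ?orbT.
  exists (\sum_j (e * c (lift ord0 j))%:R * u j).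
    apply/mapP; exists [ffun j => Ordinal (ecp j)]; first by rewrite mem_enum.
    by apply: eq_bigr => j _; rewrite ffunE.
  have -> : \sum_j (e * c (lift ord0 j))%:R * u j =
      e%:R * \sum_j (c (lift ord0 j))%:R * u j.
    by rewrite mulr_sumr; apply: eq_bigr => j _; rewrite natrM mulrA.
  set t := \sum_j _ in cy *.
  have -> : y - e%:R * t = (1 + e * c ord0)%:R * y - e%:R * ((c ord0)%:R * y + t).
    by rewrite natrD natrM; ring.
  apply: le_lt_trans (snormB hs _ _) _; rewrite gt_max !(snormM hs).
  rewrite (le_lt_trans _ e1) ?ler_piMr ?(snorm_ge0 hs)//=.
  by apply: le_lt_trans cy; rewrite ler_piMl ?(snorm_ge0 hs)// snorm_nat_le1.
have [[u /residually_free_dim]|//] := step (\dim {:F}).+1.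
by rewrite ltnn.
Qed.

Variable pi : F.
Hypothesis hpi : uniformizer absF pi.

(** Expansions in powers of [pi] with residue representatives as digits give nets of the unit ball;
    multiplication by a power of [pi] moves the ball of radius [B] into it. *)
Lemma finite_net (B e : R) : 0 < e -> exists s : seq F, forall y, absF y <= B ->
  exists2 y', y' \in s & absF (y - y') <= e.
Proof.
move=> e0; have [pi0 pi1 piP] := hpi; have [s0 hs0] := residue_net.
have abspi0 : 0 < absF pi by apply: snorm_gt0.
have pw k : exists s : seq F, forall y, absF y <= 1 ->
    exists2 y', y' \in s & absF (y - y') <= absF pi ^+ k.
  elim: k => [|k [s IH]].
    by exists [:: 0] => y y1; exists 0; rewrite ?inE// subr0 expr0.
  exists [seq y + pi ^+ k * r | y <- s, r <- s0] => y /IH[y1 y1s h1].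
  have pik : pi ^+ k != 0 by rewrite expf_neq0.
  have [|r rs hr] := hs0 ((y - y1) / pi ^+ k).
    by rewrite (snormM hs) (snormV hs) (snormX hs) ler_pdivrMr ?exprn_gt0// mul1r.
  exists (y1 + pi ^+ k * r); first by apply/allpairsP; exists (y1, r).
  have -> : y - (y1 + pi ^+ k * r) = pi ^+ k * ((y - y1) / pi ^+ k - r) by field.
  by rewrite (snormM hs) (snormX hs) exprSr ler_pM2l ?exprn_gt0// piP.
have [M hM] : exists M, absF pi ^+ M <= (Num.max B 1)^-1.
  by apply: expr_small; rewrite ?pi1 ?(ltW abspi0)// invr_gt0 lt_max ltr01 orbT.
have [k hk] : exists k, absF pi ^+ k <= e * absF pi ^+ M.
  by apply: expr_small; rewrite ?pi1 ?(ltW abspi0)// mulr_gt0// exprn_gt0.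
have [s h] := pw k; exists [seq y / pi ^+ M | y <- s] => y yB.
have piM : pi ^+ M != 0 by rewrite expf_neq0.
have [|y' ys hy] := h (y * pi ^+ M).
  rewrite (snormM hs) (snormX hs).
  apply: (@le_trans _ _ (Num.max B 1 * (Num.max B 1)^-1)).
    by rewrite ler_pM ?(snorm_ge0 hs) ?exprn_ge0 ?(ltW abspi0)// le_max yB.
  by rewrite divff// gt_eqF// lt_max ltr01 orbT.
exists (y' / pi ^+ M); first by apply/mapP; exists y'.
have -> : y - y' / pi ^+ M = (y * pi ^+ M - y') / pi ^+ M by field.
rewrite (snormM hs) (snormV hs) (snormX hs) ler_pdivrMr ?exprn_gt0//.
exact: le_trans hk.
Qed.

End FiniteNet.

(** * The retraction *)

Section Retraction.
Variables (R : realType) (F : fieldType) (abs : F -> R) (pi : F) (n d : nat).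
Hypothesis habs : nonarch_abs abs.
Hypothesis hpi : uniformizer abs pi.

Let hs := nonarch_abs_seminorm habs.
Let pi_neq0 : pi != 0. Proof. by case: hpi. Qed.
Let pi_gt0 : 0 < abs pi. Proof. exact: snorm_gt0. Qed.
Let pi_lt1 : abs pi < 1. Proof. by case: hpi. Qed.

Local Notation bnorm := (basis_norm abs pi).
Local Notation E := {ffun 'I_d -> 'I_n}.

(** The product of the norms of the basis vectors picked by [f], the factor that normalizes the
    Pluecker coordinate [f]. *)
Definition weight (a : 'I_n -> R) (f : 'I_d -> 'I_n) : R :=
  \prod_j abs pi `^ a (f j).

Lemma weight_gt0 a f : 0 < weight a f.
Proof. by apply: prodr_gt0 => j _; exact: powR_gt0. Qed.

Lemma weightE a f : weight a f = abs pi `^ \sum_j a (f j).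
Proof.
apply/esym/(big_morph (fun x => abs pi `^ x)); last exact: powRr0.
by move=> x y; rewrite powRD ?(gt_eqF pi_gt0) ?implybT.
Qed.

Lemma apt_point_eq (g g' : 'M[F]_n) a a' :
  apt_point abs pi g a = apt_point abs pi g' a' ->
  exists2 c : R, 0 < c & forall w, bnorm g a w = c * bnorm g' a' w.
Proof.
move=> e; suff : apt_point abs pi g' a' (bnorm g a) by [].
by rewrite -e; exists 1 => // w; rewrite mul1r.
Qed.

(** By definition of the fibre, [x] is a torus element times an integral stable [W]. The weights at
    [z] cancel the torus element, so the normalized coordinates of [x] have the sizes of the minors
    of [W] up to the constant [C], and [stable_weight] applies to [W]. *)
Lemma fibre_data m (z : building abs pi n) (x : berk abs n d) g a :
  (0 < m)%N -> (n %| m)%N -> coprime d n ->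
  fibre m z x -> g \in unitmx -> sval z = apt_point abs pi g a ->
  exists C : R, [/\ 0 < C,
    forall f : E, berk_val x (lform (invmx g) f) * weight a f <= C
  & forall mu : 'I_n -> R, exists2 f : E,
      berk_val x (lform (invmx g) f) * weight a f = C &
      forall i i', mu i - mu i' <= n%:R * \sum_j mu (f j) - d%:R * \sum_i mu i].
Proof.
move=> m0 nm dn xz gu za.
have [|K [iota [absK [t [W [[habsK _ absE] t0 [W1 [I0 hI0] hf] [c c0 hc] za']]]]]] :=
  xz g gu; first by exists a.
move: hf => [k [f [[[j j0 kE] fk finv] f1 fW]]].
have hK := nonarch_abs_seminorm habsK.
have tau_inj : injective (fun i : nat => pi ^+ i).
  move=> i1 i2 /(congr1 abs); rewrite !(snormX hs).
  by apply: ieexprIn; rewrite // lt_eqF.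
have p1 I : absK (plucker W I) <= 1 by exact: minor_le1.
have act0 : exists f0 : E, absK (\det (rowsub f0 W)) = 1.
  exists [ffun j => pidx_val I0 j]; rewrite -hI0 /plucker; congr (absK (\det _)).
  by apply/matrixP => u v; rewrite !mxE ffunE.
have semi (S : {set 'I_n}) : exists2 f : E,
    absK (\det (rowsub f W)) = 1 & (d * #|S| <= n * #|[pred j | f j \in S]|)%N.
  have [|||I I1 IS] := invariant_section_semistable hK tau_inj S _ _ fk finv _ p1 fW.
  - by rewrite kE muln_gt0 m0.
  - by rewrite kE dvdn_mulr.
  - by move=> mon; rewrite absE.
  exists [ffun j => pidx_val I j].
    rewrite -I1 /plucker; congr (absK (\det _)).
    by apply/matrixP => u v; rewrite !mxE ffunE.
  apply: leq_trans IS _; rewrite leq_mul2l; apply/orP; right.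
  by apply: subset_leq_card; apply/fintype.subsetP => u; rewrite !inE ffunE.
have stab := stable_weight hK W1 dn act0 semi.
set a' : 'I_n -> R := fun i => _ in za'.
(* Both [a] and [a'] give the point [z], so the two norms differ by a factor [kap]. *)
have [kap kap0 hkap] := apt_point_eq (etrans (esym za) za').
have lnpi : ln (abs pi) != 0 by rewrite lt_eqF// ln_lt0// pi_gt0.
have aE i : abs pi `^ a i = kap * (absK (t i))^-1.
  rewrite -(basis_norm_col pi habs a i gu) hkap basis_norm_col//; congr (_ * _).
  rewrite powRN; congr (_^-1); rewrite /powR gt_eqF// divfK// lnK//.
  by rewrite posrE (snorm_gt0 hK).
set M := torus_mx _ _ *m _ in hc.
have gMu : map_mx iota g \in unitmx by rewrite map_unitmx.
have lformE (e : E) : berk_val x (lform (invmx g) e) * weight a e =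
    c^-1 * kap ^+ d * absK (\det (rowsub e W)).
  have := hc 1%N _ (lform_homog (invmx g) e); rewrite expr1 peval_lform.
  have -> : map_mx iota (invmx g) *m M = diag_mx (\row_i t i) *m W.
    by rewrite /M /torus_mx map_invmx -!mulmxA mulKmx// mulKmx.
  have -> : rowsub e (diag_mx (\row_i t i) *m W) =
      diag_mx (\row_j t (e j)) *m rowsub e W.
    by rewrite !mul_diag_mx; apply/matrixP => u v; rewrite !mxE.
  rewrite det_mulmx det_diag (snormM hK) (snorm_prod hK) => eq1.
  have -> : weight a e = kap ^+ d * (\prod_j absK (t (e j)))^-1.
    rewrite /weight (eq_bigr _ (fun j _ => aE (e j))) big_split /= prodfV.
    by rewrite prodr_const card_ord.
  have tne : \prod_j absK (t (e j)) != 0.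
    by apply/prodf_neq0 => j' _; rewrite gt_eqF// (snorm_gt0 hK).
  have -> : berk_val x (lform (invmx g) e) =
      c^-1 * (\prod_j absK (t (e j)) * absK (\det (rowsub e W))).
    rewrite -[LHS](mulKf (lt0r_neq0 c0)) -eq1; congr (_ * (_ * _)).
    by apply: eq_bigr => j' _; rewrite mxE.
  by field; rewrite tne lt0r_neq0.
exists (c^-1 * kap ^+ d); split.
- by rewrite mulr_gt0 ?invr_gt0 ?exprn_gt0.
- move=> e; rewrite lformE ler_piMr ?minor_le1//.
  by rewrite mulr_ge0 ?invr_ge0 ?exprn_ge0 ?ltW.
- move=> mu; have [e e1 he] := stab mu; exists e => //.
  by rewrite lformE e1 mulr1.
Qed.

Lemma berk_lform_coef g b g' b' (f e : E) :
  g \in unitmx -> bnorm g b =1 bnorm g' b' ->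
  abs (\prod_j (invmx g' *m g) (f j) (e j)) * weight b' f <= weight b e.
Proof.
move=> gu eqn; rewrite (snorm_prod hs) /weight -big_split /=.
apply: ler_prod => j _; rewrite mulr_ge0 ?powR_ge0 ?(snorm_ge0 hs)//=.
exact: basis_norm_entry.
Qed.

(** A change between bases adapted to one norm has coefficients of size at most 1 on the normalized
    coordinates, so the ultrametric inequality keeps the bound [C]. *)
Lemma berk_lform_le (x : berk abs n d) g b g' b' C :
  g \in unitmx -> bnorm g b =1 bnorm g' b' -> 0 <= C ->
  (forall f : E, berk_val x (lform (invmx g) f) * weight b f <= C) ->
  forall f : E, berk_val x (lform (invmx g') f) * weight b' f <= C.
Proof.
move=> gu eqn C0 le f; have hx := berk_seminorm habs x.
have -> : invmx g' = invmx g' *m g *m invmx g by rewrite mulmxK.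
rewrite berk_val_lform_mul// -ler_pdivlMr ?weight_gt0//.
apply: (snorm_sum_le hx) => [|e _]; first by rewrite divr_ge0// ltW// weight_gt0.
rewrite berk_valZ ler_pdivlMr ?weight_gt0// mulrAC.
apply: le_trans (le e); rewrite [leRHS]mulrC ler_wpM2r ?(snorm_ge0 hx)//.
exact: berk_lform_coef.
Qed.

(** With [k] such that [rho / abs pi ^+ k] is at least 1, the least [M] that meets the upper bound
    meets the lower one by minimality. *)
Lemma scale_abs (rho : R) : 0 < rho ->
  exists2 l, l != 0 & 1 <= abs l * rho <= (abs pi)^-1.
Proof.
move=> rho0; have pi01 : 0 <= abs pi < 1 by rewrite ltW.
have [k hk] := expr_small pi01 rho0.
have ex : exists M, abs pi ^+ M * (rho / abs pi ^+ k) <= (abs pi)^-1.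
  have q0 : 0 < rho / abs pi ^+ k by rewrite divr_gt0// exprn_gt0.
  have [|M hM] := @expr_small _ _ ((abs pi)^-1 / (rho / abs pi ^+ k)) pi01.
    by rewrite divr_gt0 ?invr_gt0.
  by exists M; rewrite -ler_pdivlMr.
case: (ex_minnP ex) => M hM minM; exists (pi ^+ M / pi ^+ k).
  by rewrite mulf_neq0 ?invr_eq0 ?expf_neq0.
rewrite (snormM hs) (snormV hs) !(snormX hs).
have -> : abs pi ^+ M / abs pi ^+ k * rho = abs pi ^+ M * (rho / abs pi ^+ k) by ring.
rewrite hM andbT; case: M hM minM => [|M] hM minM.
  by rewrite expr0 mul1r ler_pdivlMr ?exprn_gt0// mul1r.
rewrite exprS -mulrA -ler_pdivrMl// mulr1 leNgt; apply/negP => /ltW/minM.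
by rewrite ltnn.
Qed.

Hypothesis net : forall B e : R, 0 < e -> exists s : seq F, forall y,
  abs y <= B -> exists2 y', y' \in s & abs (y - y') <= e.

(* Up to scaling and small perturbations there are only finitely many linear
   forms [lform (invmx g) I] with [g] adapted to the given norm. *)
Lemma near_active_lform (x0 : berk abs n d) g0 a0 C0 theta :
  g0 \in unitmx -> 0 < C0 -> 0 < theta < 1 ->
  (forall f : E, berk_val x0 (lform (invmx g0) f) * weight a0 f <= C0) ->
  \forall x \near x0, forall g b, g \in unitmx -> bnorm g b =1 bnorm g0 a0 ->
    forall I J : E, berk_val x0 (lform (invmx g) I) * weight b I = C0 ->
    theta * (berk_val x (lform (invmx g) J) * weight b J) <
    berk_val x (lform (invmx g) I) * weight b I.
Proof.
move=> g0u C00 /andP[th0 th1] x0le.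
(* [B] bounds the coefficients of the scaled forms below. As [eps] is at most [theta / 2] times
   every weight, rounding costs at most [theta / 2] times the largest normalized coordinate. *)
pose B := \sum_(e : E) (abs pi)^-1 * weight a0 e.
pose eps := theta / 2 / (1 + \sum_(e : E) (weight a0 e)^-1).
have wV0 : 0 <= \sum_(e : E) (weight a0 e)^-1.
  by apply: sumr_ge0 => e _; rewrite invr_ge0 ltW// weight_gt0.
have eps0 : 0 < eps by rewrite !divr_gt0// ltr_wpDr.
have epsE (e : E) : eps <= theta / 2 * weight a0 e.
  have hf : 0 <= theta / 2 by rewrite divr_ge0// ltW.
  rewrite /eps ler_pdivrMr ?ltr_wpDr// -(mulrA (theta / 2)) ler_peMr//.
  rewrite mulrDr mulr1 (bigD1 e)//= mulrDr divff ?gt_eqF ?weight_gt0//.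
  have h1 : 0 <= weight a0 e by rewrite ltW// weight_gt0.
  have h2 : 0 <= weight a0 e * \sum_(i | i != e) (weight a0 i)^-1.
    by rewrite mulr_ge0// sumr_ge0// => i _; rewrite invr_ge0 ltW// weight_gt0.
  lra.
have [s hs'] := net B eps0.
pose L (c : {ffun E -> 'I_(size s)}) : polyring n d F :=
  \sum_(e : E) nth 0 s (c e) *: lform (invmx g0) e.
have Lh c : homog 1 (L c).
  by apply: rpred_sum => e _; apply/dhomogZ; exact: lform_homog.
(* A net form is compared at [x] with a coordinate. The inequality holds at [x0] since [theta < 1],
   and only finitely many are imposed. *)
pose G (cf : {ffun E -> 'I_(size s)} * E) : set (berk abs n d) := fun x =>
    0 < berk_val x0 (L cf.1) ->
    theta * berk_val x0 (L cf.1) * weight a0 cf.2 *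
      berk_val x (lform (invmx g0) cf.2) < C0 * berk_val x (L cf.1).
have nearL : \forall x \near x0, forall cf, G cf x.
  apply: (@filter_forall _ _ G (nbhs x0)).
  move=> [c f]; rewrite /G /=.
  have [L0|nL0] := pselect (0 < berk_val x0 (L c)); last by apply: nearW => x /nL0.
  have h : theta * berk_val x0 (L c) * weight a0 f *
      berk_val x0 (lform (invmx g0) f) < C0 * berk_val x0 (L c).
    rewrite -mulrA [weight _ _ * _]mulrC [C0 * _]mulrC -mulrA mulrCA ltr_pM2l//.
    apply: le_lt_trans (_ : theta * C0 < C0); first by rewrite ler_pM2l.
    by rewrite gtr_pMl.
  near=> x => _; near: x; apply: open_nbhs_nbhs; split=> //.
  exact: open_berk_lt (lform_homog _ _) (Lh c).
near=> x; have xL : forall cf, G cf x by near: x.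
move=> g b gu eqn I J act.
have hx := berk_seminorm habs x; have hx0 := berk_seminorm habs x0.
pose v (e : E) := berk_val x (lform (invmx g0) e) * weight a0 e.
pose e1 := [arg max_(e > I) v e]%O.
have vmax e : v e <= v e1 by rewrite /e1; case: arg_maxP => // j _; exact.
have v0 : 0 <= v e1 by rewrite mulr_ge0 ?(snorm_ge0 hx)// ltW// weight_gt0.
have Jle : berk_val x (lform (invmx g) J) * weight b J <= v e1.
  exact: (berk_lform_le g0u (fun w => esym (eqn w))).
have wI := weight_gt0 b I.
have wV : 0 < (weight b I)^-1 by rewrite invr_gt0.
have [l l0 /andP[l1 l2]] := scale_abs wV.
pose h := invmx g *m g0.
pose c e := l * \prod_j h (I j) (e j).
have c_le (e : E) : abs (c e) <= (abs pi)^-1 * weight a0 e.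
  rewrite (snormM hs); apply: (@le_trans _ _ (abs l / weight b I * weight a0 e)).
    rewrite -mulrA ler_wpM2l ?(snorm_ge0 hs)// ler_pdivlMl// mulrC.
    exact: (berk_lform_coef _ _ g0u (fun w => esym (eqn w))).
  by rewrite ler_wpM2r// ltW// weight_gt0.
have /choice[c' hc'] : forall e : E, exists i : 'I_(size s), abs (c e - nth 0 s i) <= eps.
  move=> e; have [|y ys hy] := hs' (c e).
    apply: le_trans (c_le e) _; rewrite /B (bigD1 e)//= lerDl sumr_ge0// => i _.
    by rewrite mulr_ge0// ?invr_ge0 ltW// weight_gt0.
  have iy : (index y s < size s)%N by rewrite index_mem.
  by exists (Ordinal iy); rewrite /= nth_index.
pose cc := [ffun e => c' e].
(* Modulo the Pluecker ideal this is [l] times [lform (invmx g) I], written in the coordinates of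
   [g0]; [L cc] rounds its coefficients to the net. *)
pose A : polyring n d F := \sum_(e : E) c e *: lform (invmx g0) e.
have AE (y : berk abs n d) : berk_val y A = abs l * berk_val y (lform (invmx g) I).
  have -> : invmx g = h *m invmx g0 by rewrite /h mulmxK.
  rewrite berk_val_lform_mul// -berk_valZ; congr (berk_val y _).
  by rewrite scaler_sumr; apply: eq_bigr => e _; rewrite scalerA.
have AL (y : berk abs n d) C : 0 <= C ->
    (forall e : E, berk_val y (lform (invmx g0) e) * weight a0 e <= C) ->
    berk_val y (A - L cc) <= theta / 2 * C.
  move=> C0' hC; have hy := berk_seminorm habs y.
  rewrite /A /L -sumrB; apply: (snorm_sum_le hy) => [|e _].
    by rewrite mulr_ge0// divr_ge0// ltW.
  rewrite ffunE -scalerBl berk_valZ.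
  apply: (@le_trans _ _ (theta / 2 * weight a0 e * berk_val y (lform (invmx g0) e))).
    by rewrite ler_wpM2r ?(snorm_ge0 hy)// (le_trans (hc' e)).
  by rewrite mulrAC -(mulrA (theta / 2)) ler_wpM2l//; lra.
have A0 : berk_val x0 A = abs l / weight b I * C0.
  by rewrite AE -act; field; rewrite gt_eqF.
have A0_ge : C0 <= berk_val x0 A by rewrite A0 ler_peMl// ltW.
(* The rounding error is below the size of [A] at [x0], so [L cc] has the same size there. At [x]
   the same follows from [L_ge]. *)
have L0E : berk_val x0 (L cc) = berk_val x0 A.
  apply: (snorm_close hx0); apply: lt_le_trans A0_ge.
  apply: le_lt_trans (AL x0 C0 (ltW C00) x0le) _; rewrite gtr_pMl//; lra.
have L_gt : theta * (abs l / weight b I) * v e1 < berk_val x (L cc).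
  have : theta * berk_val x0 (L cc) * weight a0 e1 *
      berk_val x (lform (invmx g0) e1) < C0 * berk_val x (L cc).
    by apply: (xL (cc, e1)); rewrite /= L0E; exact: lt_le_trans A0_ge.
  rewrite L0E A0 => lt; rewrite -(ltr_pM2l C00); apply: le_lt_trans lt.
  by rewrite le_eqVlt; apply/orP; left; apply/eqP; rewrite /v; ring.
have L_ge : theta * v e1 < berk_val x (L cc).
  apply: le_lt_trans L_gt; rewrite -mulrA ler_wpM2l ?(ltW th0)//.
  by rewrite ler_peMl.
have xE : berk_val x A = berk_val x (L cc).
  apply: (snorm_close hx); rewrite -(snormN hx) opprB.
  apply: le_lt_trans L_ge; apply: le_trans (AL x (v e1) v0 vmax) _.
  by rewrite ler_wpM2r//; lra.
rewrite -xE AE in L_gt.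
have absl : 0 < abs l by apply: snorm_gt0.
apply: le_lt_trans (_ : theta * v e1 < _); first by rewrite ler_pM2l.
rewrite -(ltr_pM2l absl) [ltRHS]mulrA -ltr_pdivrMr//; apply: le_lt_trans L_gt.
by rewrite le_eqVlt; apply/orP; left; apply/eqP; ring.
Unshelve. all: by end_near. Qed.

End Retraction.

Theorem theorem5p11 (R : realType) (p : nat) (Qp : fieldType) (absQ : Qp -> R)
    (hQp : padic_numbers p absQ)
    (F : fieldExtType Qp) (absF : F -> R) (habs : nonarch_abs absF)
    (hext : forall c : Qp, absF c%:A = absQ c)
    (pi : F) (hpi : uniformizer absF pi)
    (n d m : nat) (hn : (2 <= n)%N) (hd : (d <= n)%N) (hdn : coprime d n)
    (hm : (0 < m)%N) (hnm : (n %| m)%N)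
    (r : set_type (stable_locus absF n d m) -> building absF pi n)
    (hr : is_retraction r) :
  continuous r.
Proof.
have hs := nonarch_abs_seminorm habs.
have pi_gt0 : 0 < absF pi by apply: snorm_gt0 => //; case: hpi.
have pi_lt1 : absF pi < 1 by case: hpi.
have lnpi : ln (absF pi) < 0 by rewrite ln_lt0// pi_gt0.
have fib x : fibre m (r x) (set_val x) by apply/hr.
move=> x0 U; rewrite nbhsE => -[V [oV Vz] VU].
have [e e0 ballV] := oV _ Vz.
have := svalP (r x0) => -[g0 g0u [a0 za0]].
have [C0 [C00 x0le x0act]] := fibre_data habs hpi hm hnm hdn (fib x0) g0u za0.
have n0 : 0 < n%:R :> R by rewrite ltr0n (leq_trans _ hn).
(* An oscillation below [n * eta / 2] gives a squared distance of at most [e ^+ 2 / (4 * n)];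
   [theta] turns [eta] into a multiplicative factor. *)
pose eta := e / n%:R ^+ 2.
have eta0 : 0 < eta by rewrite divr_gt0// exprn_gt0.
pose theta := absF pi `^ eta.
have theta01 : 0 < theta < 1.
  rewrite powR_gt0//= /theta /powR gt_eqF// -expR0 ltr_expR.
  by rewrite pmulr_rlt0.
have near0 := near_active_lform habs hpi (finite_net hQp habs hext hpi) g0u C00
  theta01 x0le.
have xnear := @initial_continuous _ _ set_val x0 _ near0.
apply: (@filterS _ (nbhs x0) _ _ _ _ xnear) => x /= hx.
apply: VU; apply: ballV.
have := svalP (r x) => -[g' g'u [a' za']].
have pi1 : absF pi != 1 by rewrite lt_eqF.
(* The basis [g] depends on [x], which is why [near0] is uniform in all bases adapted to the norm at
   [x0]. *)
have [g [b [gu gb ga]]] := common_apartment habs pi_gt0 a0 a' pi1 g0u g'u.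
have apt_eq (h h' : 'M[F]_n) u u' : basis_norm absF pi h u =1 basis_norm absF pi h' u' ->
    apt_point absF pi h u = apt_point absF pi h' u'.
  by move=> E; apply/seteqP; split=> N [c c0 hN]; exists c => // w; rewrite hN E.
have z0E : sval (r x0) = apt_point absF pi g a0 by rewrite za0 (apt_eq _ _ _ _ gb).
have zE : sval (r x) = apt_point absF pi g b by rewrite za' (apt_eq _ _ _ _ ga).
have [C [Cgt gle gact]] := fibre_data habs hpi hm hnm hdn (fib x0) gu z0E.
have [D [Dgt xle xact]] := fibre_data habs hpi hm hnm hdn (fib x) gu zE.
(* The maximum of the normalized coordinates depends only on the norm, not on the adapted basis. *)
have CE : C = C0.
  apply: le_anti; apply/andP; split.
    have [f <- _] := gact (fun=> 0).
    exact: (berk_lform_le habs hpi g0u (fun w => esym (gb w)) (ltW C00) x0le).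
  have [f <- _] := x0act (fun=> 0).
  exact: (berk_lform_le habs hpi gu gb (ltW Cgt) gle).
pose lam i := b i - a0 i.
have [I actI hI] := gact (fun i => - lam i).
have [J actJ hJ] := xact lam.
have wE f : weight absF pi a0 f =
    weight absF pi b f * absF pi `^ (- \sum_(j < d) lam (f j)).
  rewrite !weightE// -powRD ?(gt_eqF pi_gt0) ?implybT//; congr (_ `^ _).
  by rewrite -sumrN -big_split; apply: eq_bigr => j _; rewrite /lam /=; ring.
(* At [x] the coordinate [J] is maximal for [b], and [I] is at most as large. Passing from [b] to
   [a0] multiplies them by powers of [absF pi], whose exponents [hx] compares. *)
have lamIJ : \sum_j lam (J j) - \sum_j lam (I j) < eta.
  have := hx g a0 gu gb I J (etrans actI CE).
  rewrite !wE 2!(mulrA (berk_val _ _)) actJ => lt.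
  have : theta * absF pi `^ (- \sum_j lam (J j)) < absF pi `^ (- \sum_j lam (I j)).
    rewrite -(ltr_pM2l Dgt) mulrCA; apply: lt_le_trans lt _.
    by rewrite ler_wpM2r ?powR_ge0.
  rewrite -powRD ?(gt_eqF pi_gt0) ?implybT// /powR gt_eqF// ltr_expR.
  by rewrite ltr_nM2r//; lra.
(* Adding the inequalities for [I] and [J] cancels the terms in [d] and doubles the left side,
   whence the division by 2. *)
have osc i i' : lam i - lam i' < n%:R * eta / 2.
  have := hI i' i; have := hJ i i'; rewrite !sumrN.
  have : n%:R * (\sum_j lam (J j) - \sum_j lam (I j)) < n%:R * eta.
    by rewrite ltr_pM2l.
  rewrite mulrBr; set u := n%:R * _; set v := n%:R * _; lra.
pose i0 : 'I_n := Ordinal (leq_trans (isT : 0 < 2)%N hn).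
(* A constant shift of [a0] does not change the point; this one makes the differences of the
   exponents equal to [lam i0 - lam i]. *)
exists g, (fun i => a0 i + lam i0), b; split=> //.
  rewrite z0E; have c0 : 0 < absF pi `^ lam i0 by rewrite powR_gt0.
  apply/seteqP; split=> N [c cgt hN].
    exists (c / absF pi `^ lam i0); first exact: divr_gt0.
    by move=> w; rewrite hN basis_norm_shift// mulrA divfK ?gt_eqF.
  exists (c * absF pi `^ lam i0); first exact: mulr_gt0.
  by move=> w; rewrite hN basis_norm_shift// mulrA.
apply: (@le_lt_trans _ _ (\sum_(i < n) (n%:R * eta / 2) ^+ 2)).
  apply: ler_sum => i _; rewrite (_ : _ - b i = lam i0 - lam i); last first.
    by rewrite /lam; ring.
  have h1 := osc i0 i; have h2 := osc i i0.
  nra.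
rewrite sumr_const card_ord -(mulr_natl (_ ^+ 2)).
have -> : n%:R * (n%:R * eta / 2) ^+ 2 = e ^+ 2 * (4 * n%:R)^-1 :> R.
  by rewrite /eta; field; rewrite gt_eqF.
rewrite gtr_pMr ?exprn_gt0// invf_lt1 ?mulr_gt0//.
have : 1 <= n%:R :> R by rewrite ler1n ltnW.
lra.
Qed.
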